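(* Let $\rho_\alpha,\rho_\beta\ge\frac12$ be real and let $n\ge1$ be an integer. Let $\theta_1^\ast,\dots,\theta_n^\ast\in[0,2\pi)$ be the minimizing data (the numbers $\cos\theta_1^\ast,\dots,\cos\theta_n^\ast$ being unique up to order) of $$I_n:=\min_{\theta_1,\dots,\theta_n}\ \max_{x\in[-1,1]}\left|(1-x)^{\rho_\alpha}(1+x)^{\rho_\beta}\prod_{k=1}^n(x-\cos\theta_k)\right|.$$ Then $$\frac{1}{2\rho_\alpha+2\rho_\beta+2n}\,\frac{d}{dz}\left\{(z-1)^{2\rho_\alpha}(z+1)^{2\rho_\beta}\prod_{k=1}^n(z-e^{i\theta_k^\ast})(z-e^{-i\theta_k^\ast})\right\}$$ is the unique minimizer of $$C_n:=\min_{a_1,\dots,a_{2n+1}\in\mathbb C}\ \max_{|z|=1}\left|(z-1)^{2\rho_\alpha-1}(z+1)^{2\rho_\beta-1}\prod_{k=1}^{2n+1}(z-a_k)\right|,$$ that is, it equals $(z-1)^{2\rho_\alpha-1}(z+1)^{2\rho_\beta-1}\prod_{k=1}^{2n+1}(z-a_k^\ast)$, where $\prod_{k=1}^{2n+1}(z-a_k^\ast)$ is the unique monic polynomial of degree $2n+1$ attaining the minimum $C_n$. Furthermore, $$C_n=2^{\,n+\rho_\alpha+\rho_\beta-1}\,I_n .$$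
   Context: The angles $\theta_k$ in $I_n$ range over $[0,2\pi)$. Powers with non-integer exponents are handled as follows: for a polynomial $Q$, $$\frac{d}{dz}\left\{(z-1)^{2\rho_\alpha}(z+1)^{2\rho_\beta}Q(z)\right\}=(z-1)^{2\rho_\alpha-1}(z+1)^{2\rho_\beta-1}\left[2\rho_\alpha(z+1)Q(z)+2\rho_\beta(z-1)Q(z)+(z^2-1)Q'(z)\right]$$ for any consistent choice of branches of the powers, and $|(z-1)^{s}|=|z-1|^{s}$, $|(z+1)^s|=|z+1|^s$ for real $s\ge0$ (identically $1$ when $s=0$), so moduli do not depend on the branch. *)

(* Defs.v *)
From HB Require Import structures.
From mathcomp Require Import all_boot all_order all_algebra all_fingroup.
From mathcomp Require Export complex.
From mathcomp Require Import all_classical all_reals all_analysis.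

Set Implicit Arguments.
Unset Strict Implicit.
Unset Printing Implicit Defensive.

Import Order.TTheory GRing.Theory Num.Theory.
Import numFieldNormedType.Exports.

Local Open Scope classical_set_scope.
Local Open Scope complex_scope.
Local Open Scope ring_scope.

(* The complex numbers are R[i]; the regular module R[i]^o is the same type,
   carrying the topology (and complex differentiation) of its modulus.
   The modulus is taken with real values, as Normc.normc.
   The convention powR 0 0 = 1 makes a weight with exponent 0 identically 1. *)

Section IntervalProblem.
Context {R : realType}.
Implicit Types (ra rb : R) (n : nat).

Definition interval_norm ra rb n (t : 'I_n -> R) : R :=
  sup [set `| (1 - x) `^ ra * (1 + x) `^ rb * \prod_(k < n) (x - cos (t k)) |
      | x in `[-1, 1]%classic].

Definition angles n : set ('I_n -> R) :=
  [set t | forall k, 0 <= t k < 2 * pi].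

Definition interval_min ra rb n : R :=
  inf [set interval_norm ra rb t | t in @angles n].

Definition interval_minimizer ra rb n (t : 'I_n -> R) : Prop :=
  angles t /\ interval_norm ra rb t = interval_min ra rb n.

End IntervalProblem.

Section CircleProblem.
Context {R : realType}.
Implicit Types (ra rb : R) (m : nat).

Definition circle_norm ra rb m (a : 'I_m -> R[i]) : R :=
  sup [set Normc.normc (z - 1) `^ (2 * ra - 1)
           * Normc.normc (z + 1) `^ (2 * rb - 1)
           * Normc.normc (\prod_(k < m) (z - a k))
      | z in [set z : R[i] | Normc.normc z = 1]].

Definition circle_min ra rb m : R :=
  inf [set circle_norm ra rb a | a in @setT ('I_m -> R[i])].

Definition circle_minimizer ra rb m (a : 'I_m -> R[i]) : Prop :=
  circle_norm ra rb a = circle_min ra rb m.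

Definition monic_roots m (a : 'I_m -> R[i]) : {poly R[i]} :=
  \prod_(k < m) ('X - (a k)%:P).

End CircleProblem.

Section Powers.
Context {R : realType}.

Definition expC (z : R[i]) : R[i] :=
  (expR (complex.Re z))%:C * (cos (complex.Im z) +i* sin (complex.Im z)).

(* L is a continuous branch of log (z - c) on the open set U, which therefore
   does not contain c. *)
Definition log_branch (U : set R[i]^o) (c : R[i]) (L : R[i]^o -> R[i]^o) :
    Prop :=
  [/\ open U, {in U, continuous L} & forall z, U z -> expC (L z) = z - c].

(* The branch of (z - c) ^ s determined by a branch L of log (z - c).  Branches
   of two powers of z - c are consistent when they come from the same L. *)
Definition branch_pow (L : R[i]^o -> R[i]^o) (s : R) (z : R[i]) : R[i] :=
  expC (s%:C * L z).

Definition circle_lift n (t : 'I_n -> R) : {poly R[i]} :=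
  \prod_(k < n) (('X - (expC (0 +i* t k))%:P) * ('X - (expC (0 +i* - t k))%:P)).

Definition weighted_lift (ra rb : R) n (t : 'I_n -> R)
    (La Lb : R[i]^o -> R[i]^o) : R[i]^o -> R[i]^o :=
  fun z => branch_pow La (2 * ra) z * branch_pow Lb (2 * rb) z
           * (circle_lift t).[z].

(* The polynomial factor of
   d/dz ((z - 1) ^ (2 ra) * (z + 1) ^ (2 rb) * Q(z)), that is, the quotient of
   this derivative by (z - 1) ^ (2 ra - 1) * (z + 1) ^ (2 rb - 1). *)
Definition deriv_factor (ra rb : R) (Q : {poly R[i]}) : {poly R[i]} :=
  (2 * ra)%:C *: (('X + 1) * Q) + (2 * rb)%:C *: (('X - 1) * Q)
  + ('X ^+ 2 - 1) * Q^`().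

End Powers.

(* Main.v *)
Require Import Defs.
From HB Require Import structures.
From mathcomp Require Import all_boot all_order all_algebra all_fingroup.
From mathcomp Require Import complex.
From mathcomp Require Import all_classical all_reals all_analysis.
From mathcomp Require Import zify ring lra.

Set Implicit Arguments.
Unset Strict Implicit.
Unset Printing Implicit Defensive.

Import Order.TTheory GRing.Theory Num.Theory.
Import numFieldNormedType.Exports.

Local Open Scope classical_set_scope.
Local Open Scope complex_scope.
Local Open Scope ring_scope.

(** Write a, b for the two exponents, w = (1-x)^a (1+x)^b, P for the monic polynomial whose roots
    are the cosines of a minimizer, and M = I_n.

    The interval. A minimizer exists by compactness of the cube of roots. The roots cut [-1,1] into
    n+1 gaps. If |w P| stayed below M on one gap, widening that gap slightly would lower the norm
    ([alternation]). So |w P| = M at points x_0 < ... < x_n of (-1,1) separated by the roots of P.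
    These are critical points of w P, so with p = prod (x - x_i) a degree count gives (b(1-x) -
    a(1+x)) P + (1-x^2) P' = -(a+b+n) p.

    Transfer to the circle. At z = u + iv with |z| = 1, the product of the (z - e^(i theta_k))(z -
    e^(-i theta_k)) is (2z)^n P(u), and the equation above turns the polynomial factor Q of the
    normalized derivative into Q(z) = (2z)^n (p(u) + i v P(u)) ([horner_deriv_factor_circle]). Since
    |z-1|^2 = 2(1-u) and |z+1|^2 = 2(1+u), the squared weighted modulus of Q is 4^(n+a+b-1) H(u),
    where H = (1-u)^(2a-1) (1+u)^(2b-1) (p^2 + (1-u^2) P^2).

    The bound H <= M^2. It is an equality at each x_i. Up to a positive weight, H' is p T with T of
    degree at most n+1. Rolle gives T a zero between consecutive x_i, and the remaining linear
    factor of T is nonpositive on [-1,1], which is where a, b >= 1/2 enters. Hence H increases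
    towards x_i on each cell cut out by these zeros ([energy_deriv_sign], [energy_le]), and the
    weighted norm of Q is 2^(n+a+b-1) M.

    Optimality. Given N nodes with nodal polynomial W, a monic f of degree N-1 satisfies sum
    f(z_i)/W'(z_i) = 1. If all terms are positive, a monic g of the same degree with |g| <= |f| at
    the nodes must equal f, by equality in the triangle inequality ([lagrange_extremal]). With the
    nodes x_i this gives uniqueness of P; with the 2n+2 points of the circle above the x_i it gives
    minimality and uniqueness of Q together, because the quotient there is P(x_i) / (2 p'(x_i)) > 0
    by interlacing. *)

(** * Lagrange interpolation and extremality of monic polynomials *)

(** Leading coefficients in Lagrange's formula: each basis polynomial [q i] is monic of degree
    [#|I|.-1]. *)
Lemma lagrange_lead (F : fieldType) (I : finType) (z : I -> F) (f : {poly F}) :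
    injective z -> (size f <= #|I|)%N ->
  f`_#|I|.-1 = \sum_i f.[z i] / (\prod_i ('X - (z i)%:P))^`().[z i].
Proof.
move=> zinj szf; set P := \prod_i _.
pose q i : {poly F} := \prod_(j | j != i) ('X - (z j)%:P).
have PE i : P = ('X - (z i)%:P) * q i by rewrite /P (bigD1 i).
have szq i : size (q i) = #|I|.
  have szP : size P = #|I|.+1.
    by rewrite /P -big_enum size_prod_XsubC -cardE; congr _.+1; exact: eq_card.
  have := szP; rewrite (PE i) size_Mmonic ?monic_prod //.
  - by rewrite size_XsubC; case.
  - by rewrite polyXsubC_eq0.
  - by move=> j _; exact: monicXsubC.
have qmon i : q i \is monic by apply: monic_prod => j _; exact: monicXsubC.
have qi i : (q i).[z i] != 0.
  rewrite horner_prod; apply/prodf_neq0 => j ji.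
  by rewrite hornerXsubC subr_eq0 (inj_eq zinj) eq_sym.
have qj i j : j != i -> (q i).[z j] = 0.
  by move=> ji; rewrite horner_prod (bigD1 j) //= hornerXsubC subrr mul0r.
have Pi i : P^`().[z i] = (q i).[z i].
  by rewrite (PE i) derivM derivXsubC mul1r hornerD hornerM hornerXsubC subrr
    mul0r addr0.
pose g := \sum_i (f.[z i] / (q i).[z i]) *: q i.
have gf : f = g.
  apply/eqP; rewrite -subr_eq0; apply/negPn/negP => nz.
  have /= := @max_poly_roots _ (f - g) [seq z i | i <- enum I] nz.
  rewrite size_map -cardE map_inj_uniq // enum_uniq => H.
  have : (size (f - g)%R <= #|I|)%N.
    rewrite (leq_trans (size_polyD _ _)) // geq_max szf size_polyN.
    rewrite (leq_trans (size_sum _ _ _)) //; apply/bigmax_leqP => i _.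
    by rewrite (leq_trans (size_scale_leq _ _)) // szq.
  rewrite leqNgt H //; apply/allP => _ /mapP[i _ ->].
  rewrite rootE !hornerE horner_sum (bigD1 i) //= big1 ?addr0 => [|j ji].
    by rewrite hornerZ divfK // subrr.
  by rewrite hornerZ (qj j i) ?mulr0 1?eq_sym.
rewrite [LHS](congr1 (fun p : {poly F} => p`_ _) gf) coef_sum.
apply: eq_bigr => i _; rewrite coefZ Pi.
have /monicP := qmon i; rewrite lead_coefE szq => ->.
by rewrite mulr1.
Qed.

(** The interpolation terms of f and of g both sum to 1, and those of f are positive and dominate
    those of g in modulus. Equality in the triangle inequality makes them agree, so f and g coincide
    at more points than the degree of g - f allows. *)
Lemma lagrange_extremal (C : numClosedFieldType) (I : finType) (z : I -> C)
    (f g : {poly C}) :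
    injective z -> f \is monic -> g \is monic ->
    size f = #|I| -> size g = #|I| ->
    (forall i, 0 < f.[z i] / (\prod_i ('X - (z i)%:P))^`().[z i]) ->
    (forall i, `|g.[z i]| <= `|f.[z i]|) ->
  g = f.
Proof.
move=> zinj fm gm szf szg fpos gf; set P := \prod_i _ in fpos.
have lead (h : {poly C}) : h \is monic -> size h = #|I| ->
    \sum_i h.[z i] / P^`().[z i] = 1.
  move=> /monicP <- szh; rewrite lead_coefE szh.
  by rewrite (@lagrange_lead _ _ z h zinj) ?szh.
have eqi i : g.[z i] / P^`().[z i] = f.[z i] / P^`().[z i].
  apply: (@normC_sum_upper _ _ predT (fun i => g.[z i] / P^`().[z i])
    (fun i => f.[z i] / P^`().[z i])); rewrite ?lead // => j _.
  by rewrite -(gtr0_norm (fpos j)) !normrM ler_wpM2r.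
have Pz i : P^`().[z i] != 0.
  by apply: contraTneq (fpos i) => ->; rewrite invr0 mulr0 ltxx.
apply/eqP; rewrite -subr_eq0; apply/negPn/negP => nz.
have /= := @max_poly_roots _ (g - f) [seq z i | i <- enum I] nz.
rewrite size_map -cardE map_inj_uniq // enum_uniq => H.
suff : (#|I| < #|I|)%N by rewrite ltnn.
apply: leq_trans (H _ isT) _.
  apply/allP => _ /mapP[i _ ->].
  by rewrite rootE !hornerE subr_eq0 -(inj_eq (mulIf (invr_neq0 (Pz i)))) eqi.
by rewrite (leq_trans (size_polyD _ _)) // size_polyN szf szg maxnn.
Qed.

Lemma lagrange_extremal_real (R : rcfType) (I : finType) (z : I -> R)
    (f g : {poly R}) :
    injective z -> f \is monic -> g \is monic ->
    size f = #|I| -> size g = #|I| ->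
    (forall i, 0 < f.[z i] / (\prod_i ('X - (z i)%:P))^`().[z i]) ->
    (forall i, `|g.[z i]| <= `|f.[z i]|) ->
  g = f.
Proof.
move=> zinj fm gm szf szg fpos gf.
have rinj := fmorph_inj (real_complex R).
apply: (map_inj_poly rinj (rmorph0 _)).
apply: (@lagrange_extremal _ _ (fun i => (z i)%:C)).
- by move=> i j /rinj/zinj.
- by rewrite map_monic.
- by rewrite map_monic.
- by rewrite size_map_poly.
- by rewrite size_map_poly.
- move=> i; set P := \prod_i _.
  have -> : P = map_poly (real_complex R) (\prod_i ('X - (z i)%:P)).
    by rewrite rmorph_prod; apply: eq_bigr => j _; rewrite rmorphB /= map_polyX map_polyC.
  by rewrite deriv_map !horner_map -fmorph_div ltcR.
- move=> i; rewrite !horner_map !normc_def /= !expr0n !addr0 !sqrtr_sqr.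
  by rewrite lecR.
Qed.

(** * Polynomials given by their roots, and the weighted derivative *)

Definition root_poly {F : nzRingType} n (s : nat -> F) : {poly F} :=
  \prod_(j < n) ('X - (s j)%:P).

Definition interlaced {F : numDomainType} n (x s : nat -> F) :=
  forall j, (j < n)%N -> x j < s j < x j.+1.

(* The numerator of d/dx ((1 - x)^a (1 + x)^b F x). *)
Definition jacobi_deriv {F : nzRingType} (a b : F) (f : {poly F}) : {poly F} :=
  (b *: (1 - 'X) - a *: (1 + 'X)) * f + (1 - 'X^2) * f^`().

Section RootPoly.
Context {F : fieldType}.
Implicit Types (f : {poly F}) (x s : nat -> F).

Lemma root_poly_monic n s : root_poly n s \is monic.
Proof. by apply: monic_prod => j _; exact: monicXsubC. Qed.

Lemma size_root_poly n s : size (root_poly n s) = n.+1.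
Proof.
rewrite /root_poly -big_enum size_prod_XsubC -cardE; congr _.+1.
by rewrite -[RHS]card_ord; exact: eq_card.
Qed.

Lemma horner_root_poly n s u : (root_poly n s).[u] = \prod_(j < n) (u - s j).
Proof. by rewrite horner_prod; apply: eq_bigr => j _; rewrite hornerXsubC. Qed.

(** [s \o bump i] is the sequence [s] with its entry [i] removed. *)
Lemma root_polyE n s i : (i <= n)%N ->
  root_poly n.+1 s = ('X - (s i)%:P) * root_poly n (s \o bump i).
Proof.
by move=> ni; rewrite /root_poly (bigD1_ord (Ordinal (ni : (i < n.+1)%N))).
Qed.

Lemma deriv_root_poly n s i : (i <= n)%N ->
  ((root_poly n.+1 s)^`()).[s i] = (root_poly n (s \o bump i)).[s i].
Proof.
move=> ni; rewrite (root_polyE _ ni) derivM derivXsubC mul1r hornerD hornerM.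
by rewrite hornerXsubC subrr mul0r addr0.
Qed.

Lemma root_poly_dvd n s f :
    {in [pred j | (j < n)%N] &, injective s} ->
    (forall j, (j < n)%N -> f.[s j] = 0) ->
  f = f %/ root_poly n s * root_poly n s.
Proof.
move=> sinj fs; apply/esym/divpK.
have -> : root_poly n s = \prod_(u <- [seq s (val j) | j <- enum 'I_n]) ('X - u%:P).
  by rewrite big_map big_enum.
apply: uniq_roots_dvdp.
  by apply/allP => _ /mapP[j _ ->]; rewrite rootE fs /=.
rewrite uniq_rootsE map_inj_in_uniq ?enum_uniq // => i j _ _ /sinj.
by rewrite !inE !ltn_ord => /(_ isT isT)/val_inj.
Qed.

Lemma root_poly_scale n s f :
    {in [pred j | (j < n)%N] &, injective s} ->
    (forall j, (j < n)%N -> f.[s j] = 0) -> (size f <= n.+1)%N ->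
  f = f`_n *: root_poly n s.
Proof.
move=> sinj fs szf.
have fE := root_poly_dvd sinj fs; set c := f %/ _ in fE.
have [c0|c0] := eqVneq c 0.
  by rewrite fE c0 mul0r coef0 scale0r.
have : (size c <= 1)%N.
  move: szf; rewrite fE size_Mmonic ?root_poly_monic // size_root_poly.
  by rewrite addnS /= -[n.+1]add1n leq_add2r.
move=> /size1_polyC; move: (c`_0) => d cE.
have /monicP := root_poly_monic n s.
rewrite lead_coefE size_root_poly /= => lead.
by rewrite fE cE mul_polyC coefZ lead mulr1.
Qed.

(** The top coefficient collects -b and -a from the linear factor and -n from -'X^2 times the
    derivative. It later identifies the constant -(a+b+n) in the critical point equation. *)
Lemma coef_jacobi_deriv a b f n k : (size f <= n.+1)%N -> (n < k)%N ->
  (jacobi_deriv a b f)`_k = - (a + b + n%:R) * (if k == n.+1 then f`_n else 0).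
Proof.
move=> szf nk.
have f0 j : (n < j)%N -> f`_j = 0.
  by move=> nj; rewrite nth_default // (leq_trans szf).
case: k nk => // k; rewrite ltnS => nk.
have -> : jacobi_deriv a b f = (b - a) *: f - (a + b) *: ('X * f)
    + (f^`() - 'X^2 * f^`()).
  rewrite /jacobi_deriv -!mul_polyC !rmorphB !rmorphD /=; ring.
rewrite !(coefB, coefD, coefZ, coefN) coefXM coefXnM !coef_deriv /=.
rewrite (f0 k.+1) ?ltnS // (f0 k.+2) ?ltnS; last exact: leqW.
rewrite eqSS; case: k nk => [|k] nk /=.
  have -> : n = 0%N by lia.
  by rewrite eqxx; ring.
rewrite !subSS subn0 /=.
have [<-|kn] := eqVneq k.+1 n.
  rewrite -mulr_natr; ring.
by rewrite f0 ?mul0rn; [ring|lia].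
Qed.

Lemma size_jacobi_deriv a b f n : (size f <= n.+1)%N ->
  (size (jacobi_deriv a b f) <= n.+2)%N.
Proof.
move=> szf; apply/leq_sizeP => k nk; rewrite (coef_jacobi_deriv _ _ szf) //.
  by rewrite gtn_eqF ?mulr0.
exact: leq_trans nk.
Qed.

End RootPoly.

(** * Interlacing sequences and the signs they force *)

Section Interlacing.
Context {R : realFieldType}.
Implicit Types (x s : nat -> R).

Lemma interlaced_lt n x s i k : interlaced n x s -> (i < k <= n)%N ->
  x i < s i /\ s k.-1 < x k /\ s i <= s k.-1.
Proof.
move=> xs; elim: k => // k IH /andP[]; rewrite ltnS => ik kn.
have /andP[h1 h2] := xs _ kn.
move: ik; rewrite leq_eqVlt => /orP[/eqP->//|ik].
have [//|h3 [h4 h5]] := IH _.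
  by rewrite ik ltnW.
by split => //; split => //=; apply: le_trans h5 _; apply/ltW/(lt_trans h4).
Qed.

Lemma interlaced_incr n x s : interlaced n x s ->
  forall i k, (i < k <= n)%N -> x i < x k.
Proof.
move=> xs i k ik; have [h1 [h2 h3]] := interlaced_lt xs ik.
exact: lt_trans h1 (le_lt_trans h3 h2).
Qed.

Lemma interlaced_inj n x s : interlaced n x s ->
  {in [pred j | (j < n.+1)%N] &, injective x}.
Proof.
move=> xs i k; rewrite !inE !ltnS => ni nk.
case: (ltngtP i k) => // ik xik.
  by have := interlaced_incr xs (introT andP (conj ik nk)); rewrite xik ltxx.
by have := interlaced_incr xs (introT andP (conj ik ni)); rewrite xik ltxx.
Qed.

Lemma interlaced_inj_in n x s : interlaced n x s ->
  {in [pred j | (j < n)%N] &, injective s}.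
Proof.
move=> xs.
suff lt i k : (i < k < n)%N -> s i < s k.
  move=> i k; rewrite !inE => ni nk.
  case: (ltngtP i k) => // ik sik.
    by have := lt i k; rewrite ik nk sik ltxx => /(_ isT).
  by have := lt k i; rewrite ik ni sik ltxx => /(_ isT).
move=> /andP[ik kn].
have /andP[h1 h2] := xs _ kn.
have [|_ [_ h]] := @interlaced_lt n x s i k xs; first by rewrite ik ltnW.
have /andP[_ h3] : x k.-1 < s k.-1 < x k.-1.+1.
  by apply: xs; apply: leq_ltn_trans kn; exact: leq_pred.
move: h3; rewrite prednK ?(leq_ltn_trans _ ik) // => h3.
exact: le_lt_trans h (lt_trans h3 h1).
Qed.

(* Each factor (u - s_j)(u - x_k), k running over the indices other than i,
   is nonnegative on the i-th cell of s. *)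
Lemma interlaced_sign n x s i u : interlaced n x s -> (i <= n)%N ->
    (forall j, (j < i)%N -> s j <= u) ->
    (forall j, (i <= j < n)%N -> u <= s j) ->
  0 <= (root_poly n s).[u] * (root_poly n (x \o bump i)).[u].
Proof.
move=> xs ni lo hi; rewrite !horner_root_poly -big_split /=.
apply: prodr_ge0 => -[j jn] _ /=; have /andP[h1 h2] := xs _ jn.
rewrite /bump; case: leqP => ij /=.
  have := hi j; rewrite ij jn add1n => /(_ isT) h; apply: mulr_le0; lra.
by have := lo j ij; rewrite add0n => h; apply: mulr_ge0; lra.
Qed.

(** Pair s_j with x_j when j < i and with x_(j+1) otherwise: both lie on the same side of x_i, so
    every factor of the quotient is positive. *)
Lemma interlaced_pos n x s i : interlaced n x s -> (i <= n)%N ->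
  0 < (root_poly n s).[x i] / ((root_poly n.+1 x)^`()).[x i].
Proof.
move=> xs ni; rewrite deriv_root_poly // !horner_root_poly -prodf_div.
apply: prodr_gt0 => -[j jn] _ /=; have /andP[h1 h2] := xs _ jn.
rewrite /bump; case: leqP => ij /=; rewrite ?add1n ?add0n.
  have h : x i <= x j.
    by move: ij; rewrite leq_eqVlt => /orP[/eqP->//|ij]; apply/ltW/(interlaced_incr xs); rewrite ij ltnW.
  by rewrite -mulrNN -invrN divr_gt0; lra.
have h : x j.+1 <= x i.
  by move: ij; rewrite leq_eqVlt => /orP[/eqP->//|ij]; apply/ltW/(interlaced_incr xs); rewrite ij.
by rewrite divr_gt0; lra.
Qed.

End Interlacing.

(** * The energy polynomial and the sign of its weighted derivative *)

Section Energy.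
Context {R : realFieldType}.
Implicit Types (a b u : R) (x s y : nat -> R).

(** At a point u + iv of the unit circle this is |p(u) + i v P(u)|^2, the squared modulus of the
    circle candidate up to the factor 4^n. *)
Definition energy n x s : {poly R} :=
  root_poly n.+1 x ^+ 2 + (1 - 'X^2) * root_poly n s ^+ 2.

Definition energy_cofactor a b n x s : {poly R} :=
  2%:P * jacobi_deriv (a - 2^-1) (b - 2^-1) (root_poly n.+1 x)
  - (2 * (a + b + n%:R))%:P * ((1 - 'X^2) * root_poly n s).

(** The difference of the two sides is 2 (1 - X^2) P times the difference of the two sides of the
    critical point equation. *)
Lemma jacobi_deriv_energy a b n x s :
    jacobi_deriv a b (root_poly n s)
      = - (a + b + n%:R) *: root_poly n.+1 x ->
  jacobi_deriv (2 * a - 1) (2 * b - 1) (energy n x s)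
    = root_poly n.+1 x * energy_cofactor a b n x s.
Proof.
rewrite /energy_cofactor /jacobi_deriv /energy.
set p := root_poly n.+1 x; set q := root_poly n s; set k := a + b + n%:R.
rewrite -!mul_polyC => hyp; apply/eqP; rewrite -subr_eq0; apply/eqP.
transitivity ((1 - 'X^2) * q * (2 * ((b%:P * (1 - 'X) - a%:P * (1 + 'X)) * q
   + (1 - 'X^2) * q^`() - (- k)%:P * p))); last by rewrite hyp subrr !mulr0.
have hE (c : R) : c%:P *+ 2 = (c - 2^-1)%:P *+ 2 + 1 :> {poly R}.
  by rewrite -!rmorphMn -polyC1 -rmorphD /=; congr (_%:P); field.
have hE' (c : R) : (2 * c - 1)%:P = (c - 2^-1)%:P *+ 2 :> {poly R}.
  by rewrite -!rmorphMn /=; congr (_%:P); field.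
rewrite !(derivD, derivM, derivB, derivN, derivXn, derivC, derivX, expr2) /=.
rewrite !hE' rmorphN rmorphM /= polyC_natr.
have -> (A B C D E : {poly R}) :
    2 * ((b%:P * A - a%:P * B) * C + D - E)
    = (b%:P *+ 2 * A - a%:P *+ 2 * B) * C + 2 * D - 2 * E by ring.
rewrite (hE a) (hE b) {hE hE' hyp}.
move: p q (a - _)%:P (b - _)%:P k%:P p^`() q^`() 'X => p q A B K p' q' X.
by ring.
Qed.

(** The two contributions to the coefficient of X^(n+2) cancel. This drop in degree leaves only a
    linear factor once n zeros are divided out. *)
Lemma size_energy_cofactor a b n x s :
  (size (energy_cofactor a b n x s) <= n.+2)%N.
Proof.
apply/leq_sizeP => k nk.
have szp := size_root_poly n.+1 x.
have sz : (size ((1 - 'X^2) * root_poly n s)%R <= n.+3)%N.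
  apply: (leq_trans (size_polyMleq _ _)); rewrite size_root_poly.
  rewrite addnS /= -[n.+3]/(3 + n)%N leq_add2r.
  by rewrite (leq_trans (size_polyD _ _)) // size_polyN size_polyXn size_poly1.
rewrite /energy_cofactor coefB !coefCM (@coef_jacobi_deriv _ _ _ _ n.+1) ?szp //.
have [->|kn] := eqVneq k n.+2.
  have /monicP := root_poly_monic n.+1 x; rewrite lead_coefE szp /= => ->.
  have /monicP := root_poly_monic n s; rewrite lead_coefE size_root_poly /= => h.
  rewrite mulrBl mul1r coefB coefXnM /= subSS subSS subn0 h.
  have -> : (root_poly n s)`_n.+2 = 0 by rewrite nth_default ?size_root_poly.
  by rewrite -natr1; field.
by rewrite (nth_default _ (leq_trans sz _)) ?mulr0 ?subr0 //; lia.
Qed.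

(** Dividing the cofactor T by q = prod (X - y_j) leaves c of degree at most one. At 1 and -1 the
    term with 1 - X^2 vanishes, so T is p times -4(a - 1/2), respectively 4(b - 1/2); with the signs
    of p q there, c is nonpositive at both ends, hence on [-1,1]. On the cell of x_i, p q (u - x_i)
    >= 0 by interlacing. *)
Lemma energy_deriv_sign a b n x s y i u :
    2^-1 <= a -> 2^-1 <= b -> interlaced n x y ->
    -1 < x 0%N -> x n < 1 ->
    (forall j, (j < n)%N -> (energy_cofactor a b n x s).[y j] = 0) ->
    (i <= n)%N -> -1 <= u <= 1 ->
    (forall j, (j < i)%N -> y j <= u) -> (forall j, (i <= j < n)%N -> u <= y j) ->
  (root_poly n.+1 x).[u] * (energy_cofactor a b n x s).[u] * (u - x i) <= 0.
Proof.
move=> ha hb xy x0 xn Ty ni /andP[um u1] lo hi.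
have TE := root_poly_dvd (interlaced_inj_in xy) Ty.
set T := energy_cofactor _ _ _ _ _ in Ty TE *; set q := root_poly n y in TE.
set c := T %/ q in TE.
have yx j : (j < n)%N -> -1 < y j < 1.
  move=> jn; have /andP[h1 h2] := xy _ jn.
  have h3 : x 0%N <= x j.
    by case: j jn {h1 h2} => // j jn; apply/ltW/(interlaced_incr xy); rewrite /= ltnW.
  have h4 : x j.+1 <= x n.
    move: jn; rewrite leq_eqVlt => /orP[/eqP->//|jn].
    by apply/ltW/(interlaced_incr xy); rewrite jn leqnn.
  by apply/andP; split; lra.
have q1 : q.[1] != 0.
  rewrite horner_root_poly; apply/prodf_neq0 => -[j jn] _ /=.
  by rewrite subr_eq0 gt_eqF; case/andP: (yx _ jn).
have qm1 : q.[-1] != 0.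
  rewrite horner_root_poly; apply/prodf_neq0 => -[j jn] _ /=.
  by rewrite subr_eq0 lt_eqF; case/andP: (yx _ jn).
have cell k v : (k <= n)%N ->
    (forall j, (j < k)%N -> y j <= v) -> (forall j, (k <= j < n)%N -> v <= y j) ->
    0 <= (root_poly n.+1 x).[v] * q.[v] * (v - x k).
  move=> nk lo' hi'; have := interlaced_sign xy nk lo' hi'.
  rewrite (root_polyE _ nk) hornerM hornerXsubC -/q => h.
  have -> (A B : R) : (v - x k) * A * B * (v - x k) = (v - x k) ^+ 2 * (B * A) by ring.
  by rewrite mulr_ge0 // sqr_ge0.
have TB v : T.[v] = c.[v] * q.[v] by rewrite {1}TE hornerM.
have Tv v : v ^+ 2 = 1 ->
    T.[v] = 2 * ((b - 2^-1) * (1 - v) - (a - 2^-1) * (1 + v)) * (root_poly n.+1 x).[v].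
  move=> v2; rewrite /T /energy_cofactor /jacobi_deriv !(hornerXn, hornerD, hornerN, hornerM, hornerZ, hornerC, hornerX) v2.
  by ring.
have c1 : c.[1] <= 0.
  have h : 0 <= (root_poly n.+1 x).[1] * q.[1] * (1 - x n).
    apply: cell => // j; first by move=> /yx/andP[_ /ltW].
    by case/andP=> h1; rewrite ltnNge h1.
  have h' : 0 <= (root_poly n.+1 x).[1] * q.[1] by rewrite -(pmulr_lge0 _ (_ : 0 < 1 - x n)) ?subr_gt0.
  have := TB 1; rewrite Tv ?expr1n // => e.
  rewrite -(pmulr_lle0 _ (_ : 0 < q.[1] ^+ 2)) ?exprn_even_gt0 //.
  have -> : c.[1] * q.[1] ^+ 2 = (- 4 * (a - 2^-1)) * ((root_poly n.+1 x).[1] * q.[1]).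
    by rewrite expr2 mulrA -e; ring.
  by apply: mulr_le0_ge0 => //; lra.
have cm1 : c.[-1] <= 0.
  have h : 0 <= (root_poly n.+1 x).[-1] * q.[-1] * (-1 - x 0%N).
    by apply: cell => // j /=; move=> /yx/andP[/ltW].
  have h' : (root_poly n.+1 x).[-1] * q.[-1] <= 0.
    by rewrite -(nmulr_lge0 _ (_ : -1 - x 0%N < 0)) ?subr_lt0.
  have := TB (-1); rewrite Tv ?sqrrN ?expr1n // => e.
  rewrite -(pmulr_lle0 _ (_ : 0 < q.[-1] ^+ 2)) ?exprn_even_gt0 //.
  have -> : c.[-1] * q.[-1] ^+ 2 = (4 * (b - 2^-1)) * ((root_poly n.+1 x).[-1] * q.[-1]).
    by rewrite expr2 mulrA -e; ring.
  by apply: mulr_ge0_le0 => //; lra.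
have cu : c.[u] <= 0.
  have [c0|c0] := eqVneq c 0; first by rewrite c0 horner0.
  have szc : (size c <= 2)%N.
    have := size_energy_cofactor a b n x s; rewrite -/T TE.
    rewrite size_Mmonic ?root_poly_monic // size_root_poly addnS /=.
    by rewrite -[n.+2]/(2 + n)%N leq_add2r.
  have cE v : c.[v] = c`_0 + c`_1 * v.
    by rewrite (horner_coef_wide _ szc) !big_ord_recl big_ord0 /= expr0 expr1 mulr1 addr0.
  move: c1 cm1; rewrite !cE => c1 cm1.
  have -> : c`_0 + c`_1 * u = ((c`_0 + c`_1 * 1) * (1 + u) + (c`_0 + c`_1 * -1) * (1 - u)) / 2.
    by field.
  have h1 : (c`_0 + c`_1 * 1) * (1 + u) <= 0 by apply: mulr_le0_ge0 => //; lra.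
  have h2 : (c`_0 + c`_1 * -1) * (1 - u) <= 0 by apply: mulr_le0_ge0 => //; lra.
  by lra.
rewrite TB.
have -> (A B C D : R) : A * (B * C) * D = B * (A * C * D) by ring.
by apply: mulr_le0_ge0 => //; exact: cell.
Qed.

End Energy.

(** * Analysis of the weight: continuity, derivative, critical points *)

Section Weight.
Context {R : realType}.
Implicit Types (a b u v : R) (f : {poly R}).

Definition weight a b u : R := (1 - u) `^ a * (1 + u) `^ b.

Lemma weight_gt0 a b u : -1 < u < 1 -> 0 < weight a b u.
Proof. by move=> /andP[h1 h2]; apply: mulr_gt0; apply: powR_gt0; lra. Qed.

Lemma weight_ge0 a b u : 0 <= weight a b u.
Proof. by apply: mulr_ge0; exact: powR_ge0. Qed.

(** This links the two problems: squaring the interval weight gives the exponents 2a - 1 and 2b - 1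
    of the circle, and the factor left over is the 1 - u^2 of the energy. *)
Lemma weight_sqr a b u : -1 <= u <= 1 -> 0 < a -> 0 < b ->
  weight a b u ^+ 2 = weight (2 * a - 1) (2 * b - 1) u * (1 - u ^+ 2).
Proof.
move=> /andP[h1 h2] a0 b0.
have sq v c : 0 <= v -> 0 < c -> (v `^ c) ^+ 2 = v `^ (2 * c - 1) * v.
  move=> v0 c0; have [->|v1] := eqVneq v 0.
    by rewrite mulr0 powR0 ?gt_eqF // expr0n.
  rewrite -[X in _ = _ * X](powRr1 v0) -powRD; last by rewrite v1 implybT.
  by rewrite expr2 -powRD ?v1 ?implybT //; congr (_ `^ _); ring.
by rewrite /weight exprMn !sq //; [ring | lra | lra].
Qed.

Lemma abs_powR_continuous a : 0 <= a -> continuous (fun u => `|u| `^ a).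
Proof.
rewrite le_eqVlt => /orP[/eqP<-|a0] u.
  have -> : (fun u => `|u| `^ 0) = cst 1 by apply/funext => v; rewrite powRr0.
  exact: cvg_cst.
have [->|u0] := eqVneq u 0.
  rewrite /prop_for /continuous_at normr0 powR0 ?gt_eqF //.
  apply/cvgr0Pnorm_lt => e e0; near=> v.
  rewrite ger0_norm ?powR_ge0 //.
  have -> : e = (e `^ a^-1) `^ a by rewrite -powRrM mulVf ?gt_eqF // powRr1 // ltW.
  apply: gt0_ltr_powR => //; rewrite ?nnegrE ?powR_ge0 ?normr_ge0 //.
  near: v; apply: (@cvgr0_norm_lt _ _ _ _ _ id) => //.
  exact: powR_gt0.
apply: (@continuous_comp _ _ _ (fun v : R => `|v|) (fun v => v `^ a)); first exact: norm_continuous.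
apply/differentiable_continuous/derivable1_diffP.
by have [] : is_derive `|u| 1 (fun v => v `^ a) (a * `|u| `^ (a - 1))
  by apply: is_derive1_powR; rewrite normr_gt0.
Unshelve. all: by end_near. Qed.

(** Taking absolute values of 1 - u and 1 + u gives a function continuous on the whole line that
    agrees with this one on [-1,1]. *)
Lemma weight_poly_continuous a b f : 0 <= a -> 0 <= b ->
  {within `[-1, 1], continuous (fun u => weight a b u * f.[u])}.
Proof.
move=> a0 b0.
apply: (@subspace_eq_continuous _ _ _
  (fun u => `|1 - u| `^ a * `|1 + u| `^ b * f.[u])).
  move=> u; rewrite inE /= in_itv /= => /andP[h1 h2]; rewrite /weight.
  by rewrite !ger0_norm //; lra.
apply: continuous_subspaceT => u.
apply: cvgM; last exact: continuous_horner.
apply: cvgM.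
  apply: (@continuous_comp _ _ _ (fun u => 1 - u) (fun v => `|v| `^ a)).
    by apply: cvgB; [exact: cvg_cst | exact: cvg_id].
  exact: abs_powR_continuous.
apply: (@continuous_comp _ _ _ (fun u => 1 + u) (fun v => `|v| `^ b)).
  by apply: cvgD; [exact: cvg_cst | exact: cvg_id].
exact: abs_powR_continuous.
Qed.

Lemma is_derive_weight_poly a b f u : -1 < u < 1 ->
  is_derive u 1 (fun v => weight a b v * f.[v])
    (weight (a - 1) (b - 1) u * (jacobi_deriv a b f).[u]).
Proof.
move=> /andP[h1 h2].
have d1 : is_derive u 1 ((fun v => v `^ a) \o (fun v => 1 - v))
    (a * (1 - u) `^ (a - 1) * (-1)).
  apply: is_derive1_comp; first by apply: is_derive1_powR; lra.
  have h : is_derive u 1 (cst 1 - id) (0 - 1 : R) by apply: is_deriveB.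
  by apply: (is_derive_eq h); rewrite sub0r.
have d2 : is_derive u 1 ((fun v => v `^ b) \o (fun v => 1 + v))
    (b * (1 + u) `^ (b - 1) * 1).
  apply: is_derive1_comp; first by apply: is_derive1_powR; lra.
  have h : is_derive u 1 (cst 1 + id) (0 + 1 : R) by apply: is_deriveD.
  by apply: (is_derive_eq h); rewrite add0r.
have e (c v : R) : 0 < v -> v `^ c = v `^ (c - 1) * v.
  move=> v0; have := @powRD _ v (c - 1) 1.
  by rewrite (gt_eqF v0) implybT subrK powRr1 ?ltW // => ->.
apply: (is_derive_eq (is_deriveM (is_deriveM d1 d2) (is_derive_poly f u))).
rewrite /= /GRing.scale /= /weight /jacobi_deriv.
rewrite !(hornerXn, hornerD, hornerN, hornerM, hornerZ, hornerC, hornerX).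
rewrite [X in X * f^`().[u]](_ : _ = (1 - u) `^ a * (1 + u) `^ b) //.
rewrite (e a (1 - u)) ?(e b (1 + u)); [ring | lra | lra].
Qed.

(** Fermat's theorem: the sign of f(c) tells whether the function without the modulus has a maximum
    or a minimum at c. *)
Lemma weight_poly_extremum a b f c : 0 < a -> 0 < b -> -1 < c < 1 ->
    f.[c] != 0 ->
    (forall u, -1 < u < 1 -> `|weight a b u * f.[u]| <= `|weight a b c * f.[c]|) ->
  (jacobi_deriv a b f).[c] = 0.
Proof.
move=> a0 b0 hc fc0 hmax.
have d u : u \in `]-1, 1[ -> derivable (fun v => weight a b v * f.[v]) u 1.
  rewrite in_itv /= => hu; exact: (@ex_derive _ _ _ _ _ _ _ (is_derive_weight_poly a b f hu)).
suff : is_derive c 1 (fun v => weight a b v * f.[v]) 0.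
  move=> d0; have d1 := is_derive_weight_poly a b f hc.
  have : weight (a - 1) (b - 1) c * (jacobi_deriv a b f).[c] = 0.
    by rewrite -(@derive_val _ _ _ _ _ _ _ d1) (@derive_val _ _ _ _ _ _ _ d0).
  by move/eqP; rewrite mulf_eq0 gt_eqF ?weight_gt0 //= => /eqP.
have cI : c \in `]-1, 1[ by rewrite in_itv.
case: (ltrgtP f.[c] 0) fc0 => // s _.
- apply: (derive1_at_min _ d cI) => [|u]; first by lra.
  rewrite in_itv /= => /hmax; rewrite ler_norml => /andP[+ _].
  by rewrite ltr0_norm ?opprK // pmulr_rlt0 // weight_gt0.
- apply: (derive1_at_max _ d cI) => [|u]; first by lra.
  rewrite in_itv /= => /hmax; rewrite ler_norml => /andP[_].
  by rewrite gtr0_norm // pmulr_rgt0 // weight_gt0.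
Qed.

Lemma weight_poly_rolle a b f u v : 0 <= a -> 0 <= b ->
    -1 <= u -> u < v -> v <= 1 ->
    weight a b u * f.[u] = weight a b v * f.[v] ->
  exists2 y, u < y < v & (jacobi_deriv a b f).[y] = 0.
Proof.
move=> a0 b0 hu uv hv e.
have d y : y \in `]u, v[ -> is_derive y 1 (fun v => weight a b v * f.[v])
    (weight (a - 1) (b - 1) y * (jacobi_deriv a b f).[y]).
  by rewrite in_itv /= => /andP[h1 h2]; apply: is_derive_weight_poly; lra.
have [|y yI H] := MVT uv d.
  have cf := weight_poly_continuous (f := f) a0 b0.
  apply: continuous_subspaceW cf => w /=.
  by rewrite !in_itv /= => /andP[h1 h2]; lra.
move: yI; rewrite in_itv /= => yI; have /andP[h1 h2] := yI.
exists y => //; apply/eqP; move: H; rewrite e subrr => /esym/eqP.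
by rewrite mulf_eq0 subr_eq0 (gt_eqF uv) orbF mulf_eq0 gt_eqF // weight_gt0 //; lra.
Qed.

(* On (-1, 1) the derivative of weight * energy has the sign of the product of
   energy_deriv_sign, so weight * energy increases towards x i on its cell. *)
Lemma energy_le a b n x s y i u :
    2^-1 <= a -> 2^-1 <= b -> interlaced n x y -> -1 < x 0%N -> x n < 1 ->
    jacobi_deriv a b (root_poly n s) = - (a + b + n%:R) *: root_poly n.+1 x ->
    (forall j, (j < n)%N -> (energy_cofactor a b n x s).[y j] = 0) ->
    (i <= n)%N -> -1 <= u <= 1 ->
    (forall j, (j < i)%N -> y j <= u) -> (forall j, (i <= j < n)%N -> u <= y j) ->
  weight (2 * a - 1) (2 * b - 1) u * (energy n x s).[u]
    <= weight (2 * a - 1) (2 * b - 1) (x i) * (energy n x s).[x i].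
Proof.
move=> ha hb xy x0 xn jac Ty ni hu lo hi.
have h3 : x 0%N <= x i.
  by case: i ni {lo hi} => // j jn; apply/ltW/(interlaced_incr xy).
have h4 : x i <= x n.
  move: ni; rewrite leq_eqVlt => /orP[/eqP->//|jn].
  by apply/ltW/(interlaced_incr xy); rewrite jn leqnn.
have xlo j : (j < i)%N -> y j <= x i.
  move=> ji; have /andP[_ /ltW h] := xy j (leq_trans ji ni).
  apply: (le_trans h); move: ji; rewrite leq_eqVlt => /orP[/eqP->//|ji].
  by apply/ltW/(interlaced_incr xy); rewrite ji ni.
have xhi j : (i <= j < n)%N -> x i <= y j.
  move=> /andP[ij jn]; have /andP[/ltW h _] := xy j jn.
  apply: le_trans h; move: ij; rewrite leq_eqVlt => /orP[/eqP->//|ij].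
  by apply/ltW/(interlaced_incr xy); rewrite ij ltnW.
have key v : -1 < v < 1 -> (forall j, (j < i)%N -> y j <= v) ->
    (forall j, (i <= j < n)%N -> v <= y j) ->
  (jacobi_deriv (2 * a - 1) (2 * b - 1) (energy n x s)).[v] * (v - x i) <= 0.
  move=> /andP[v1 v2] vlo vhi; rewrite (jacobi_deriv_energy jac) hornerM.
  by apply: (energy_deriv_sign ha hb xy) => //; lra.
have d v : -1 < v < 1 -> is_derive v 1
    (fun v => weight (2 * a - 1) (2 * b - 1) v * (energy n x s).[v])
    (weight (2 * a - 1 - 1) (2 * b - 1 - 1) v
     * (jacobi_deriv (2 * a - 1) (2 * b - 1) (energy n x s)).[v]).
  by move=> hv; exact: is_derive_weight_poly.
have dI c e : -1 <= c -> e <= 1 -> forall v, v \in `]c, e[ -> is_derive v 1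
    (fun v => weight (2 * a - 1) (2 * b - 1) v * (energy n x s).[v])
    (weight (2 * a - 1 - 1) (2 * b - 1 - 1) v
     * (jacobi_deriv (2 * a - 1) (2 * b - 1) (energy n x s)).[v]).
  by move=> hc he v; rewrite in_itv /= => /andP[h1 h2]; apply: d; lra.
have cont c e : -1 <= c -> e <= 1 -> {within `[c, e], continuous
    (fun v => weight (2 * a - 1) (2 * b - 1) v * (energy n x s).[v])}.
  move=> hc he; have a0 : 0 <= 2 * a - 1 by lra. have b0 : 0 <= 2 * b - 1 by lra.
  have cf := weight_poly_continuous (f := energy n x s) a0 b0.
  apply: continuous_subspaceW cf => w /=.
  by rewrite !in_itv /= => /andP[h1 h2]; lra.
have /andP[u1 u2] := hu.
case: (ltgtP u (x i)) => [ux|xu|->//].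
- have xi1 : x i <= 1 by lra.
  have [v] := MVT ux (dI _ _ u1 xi1) (cont _ _ u1 xi1).
  rewrite in_itv /= => /andP[h1 h2] e; rewrite -subr_ge0 e.
  have hv : -1 < v < 1 by lra.
  apply: mulr_ge0; last by lra.
  apply: mulr_ge0; first exact: weight_ge0.
  rewrite -(nmulr_lle0 _ (_ : v - x i < 0)) ?subr_lt0 //; apply: key => // j.
    by move=> /lo h; lra.
  by move=> /xhi h; lra.
- have xi1 : -1 <= x i by lra.
  have [v] := MVT xu (dI _ _ xi1 u2) (cont _ _ xi1 u2).
  rewrite in_itv /= => /andP[h1 h2] e; rewrite -subr_le0 e.
  have hv : -1 < v < 1 by lra.
  apply: mulr_le0_ge0; last by lra.
  apply: mulr_ge0_le0; first exact: weight_ge0.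
  rewrite -(pmulr_lle0 _ (_ : 0 < v - x i)) ?subr_gt0 //; apply: key => // j.
    by move=> /xlo h; lra.
  by move=> /hi h; lra.
Qed.

End Weight.

(** * The interval problem: competitors and existence of a minimizer *)

Section IntervalMin.
Context {R : realType}.
Implicit Types (a b u M : R) (f g h : {poly R}).

Lemma sup_max (E : set R) m : E m -> (forall v, E v -> v <= m) -> sup E = m.
Proof.
move=> Em ub; apply/eqP; rewrite eq_le; apply/andP; split.
  by apply: ge_sup => //; exists m.
by apply: ub_le_sup => //; exists m.
Qed.

Lemma weight_poly_max a b f (lo hi : R) : 0 <= a -> 0 <= b ->
    -1 <= lo -> lo <= hi -> hi <= 1 ->
  exists2 c, lo <= c <= hi &
    forall u, lo <= u <= hi -> `|weight a b u * f.[u]| <= `|weight a b c * f.[c]|.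
Proof.
move=> a0 b0 hlo lohi hhi.
have cf : {within `[lo, hi], continuous (fun u => `|weight a b u * f.[u]|)}.
  have cf := weight_poly_continuous (f := f) a0 b0.
  have {}cf : {within `[lo, hi], continuous (fun u => weight a b u * f.[u])}.
    apply: continuous_subspaceW cf => w /=.
    by rewrite !in_itv /= => /andP[h1 h2]; lra.
  move=> u; apply: (@continuous_comp (subspace `[lo, hi]) R R
    (fun u => weight a b u * f.[u]) (fun v => `|v|)); first exact: cf.
  exact: norm_continuous.
have [c cI hc] := EVT_max lohi cf.
exists c => [|u hu]; first by move: cI; rewrite in_itv.
by apply: hc; rewrite in_itv.
Qed.

Lemma interval_normP a b n (t : 'I_n -> R) (f : {poly R}) : 0 <= a -> 0 <= b ->
    f = \prod_(k < n) ('X - (cos (t k))%:P) ->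
  exists c, [/\ -1 <= c <= 1, interval_norm a b t = `|weight a b c * f.[c]| &
    forall u, -1 <= u <= 1 -> `|weight a b u * f.[u]| <= interval_norm a b t].
Proof.
move=> a0 b0 fE.
have ff u : \prod_(k < n) (u - cos (t k)) = f.[u].
  by rewrite fE horner_prod; apply: eq_bigr => k _; rewrite hornerXsubC.
have [|||c hc cmax] := @weight_poly_max a b f (-1) 1 a0 b0; try by lra.
suff E : interval_norm a b t = `|weight a b c * f.[c]|.
  by exists c; split => // u hu; rewrite E; exact: cmax.
rewrite /interval_norm; apply: sup_max.
  by exists c; [rewrite /= in_itv|rewrite ff].
by move=> _ [u + <-]; rewrite /= in_itv /= ff; exact: cmax.
Qed.

Lemma interval_norm_ge0 a b n (t : 'I_n -> R) : 0 <= a -> 0 <= b ->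
  0 <= interval_norm a b t.
Proof. by move=> a0 b0; have [c [_ -> _]] := interval_normP a0 b0 (erefl (\prod_(k < n) ('X - (cos (t k))%:P))). Qed.

Lemma interval_min_le a b n (t : 'I_n -> R) : 0 <= a -> 0 <= b ->
  angles t -> interval_min a b n <= interval_norm a b t.
Proof.
move=> a0 b0 ht; apply: ge_inf; last by exists t.
by exists 0 => _ [t' _ <-]; exact: interval_norm_ge0.
Qed.

(** Allows arbitrary real roots as competitors: pushing a root into [-1,1] makes it a cosine and
    moves it no farther from any point of the interval. *)
Definition clamp u : R := Num.max (-1) (Num.min u 1).

Lemma clamp_itv u : -1 <= clamp u <= 1.
Proof. by rewrite /clamp le_max lexx /= ge_max ge_min lexx orbT andbT; lra. Qed.

Lemma clampK u : -1 <= u <= 1 -> clamp u = u.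
Proof. by move=> /andP[h1 h2]; rewrite /clamp (min_idPl h2) (max_idPr h1). Qed.

Lemma dist_clamp u v : -1 <= u <= 1 -> `|u - clamp v| <= `|u - v|.
Proof.
move=> /andP[h1 h2]; rewrite /clamp.
have [v1|v1] := leP v 1; last first.
  rewrite (max_idPr _); last by lra.
  by rewrite ler0_norm ?ler0_norm; lra.
have [v2|v2] := leP (-1) v => //.
by rewrite ger0_norm ?ger0_norm; lra.
Qed.

Lemma clamp_angles n (c : 'I_n -> R) : angles (fun k => acos (clamp (c k))).
Proof.
move=> k; have := clamp_itv (c k) => h.
rewrite acos_ge0 //= (le_lt_trans (acos_lepi h)) //.
by have := pi_gt0 R; lra.
Qed.

Lemma interval_norm_acos_le a b n (c : 'I_n -> R) M : 0 <= a -> 0 <= b ->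
    (forall u, -1 <= u <= 1 -> `|weight a b u * \prod_(k < n) (u - c k)| <= M) ->
  interval_norm a b (fun k => acos (clamp (c k))) <= M.
Proof.
move=> a0 b0 hM.
have [u [hu -> _]] := interval_normP a0 b0 (erefl (\prod_(k < n) ('X - (cos (acos (clamp (c k))))%:P))).
apply: le_trans (hM u hu).
rewrite !normrM ler_wpM2l // horner_prod !normr_prod.
apply: ler_prod => k _; rewrite normr_ge0 /= hornerXsubC.
by rewrite acosK ?dist_clamp // in_itv /= clamp_itv.
Qed.

Lemma interval_min_le_roots a b n (c : 'I_n -> R) M : 0 <= a -> 0 <= b ->
    (forall u, -1 <= u <= 1 -> `|weight a b u * \prod_(k < n) (u - c k)| <= M) ->
  interval_min a b n <= M.
Proof.
move=> a0 b0 hM; apply: le_trans (interval_norm_acos_le a0 b0 hM).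
by apply: interval_min_le => //; exact: clamp_angles.
Qed.

(** The cosines along a minimizing sequence stay in a compact cube. A cluster point is optimal
    because, for each fixed u, the weighted product is continuous in the roots. *)
Lemma interval_minimizer_exists a b n : 0 <= a -> 0 <= b ->
  exists t : 'I_n -> R, interval_minimizer a b t.
Proof.
move=> a0 b0.
have hinf : has_inf [set interval_norm a b t | t in @angles R n].
  split; last by exists 0 => _ [t' _ <-]; exact: interval_norm_ge0.
  exists (interval_norm a b (fun k : 'I_n => acos (clamp 0))).
  by exists (fun k => acos (clamp 0)) => //; exact: (clamp_angles (fun=> 0)).
have /choice[T hT] : forall m : nat, exists t : 'I_n -> R,
    interval_norm a b t < interval_min a b n + m.+1%:R^-1.
  move=> m; have [|_ [t _ <-] ht] := @inf_adherent _ _ m.+1%:R^-1 _ hinf.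
    by rewrite invr_gt0.
  by exists t.
pose v m : 'rV[R]_n := \row_k cos (T m k).
have cpt : compact [set q : 'rV[R]_n | forall k, `[-1, 1]%classic (q ord0 k)].
  exact: (@rV_compact R n (fun=> `[-1, 1]%classic) (fun=> @segment_compact R (-1) 1)).
have vI : (v @ \oo) [set q : 'rV[R]_n | forall k, `[-1, 1]%classic (q ord0 k)].
  by exists 0%N => // m _ k; rewrite /= in_itv /= mxE cos_geN1 cos_le1.
have [p [_ hp]] := cpt _ (fmap_proper_filter _ _) vI.
exists (fun k => acos (clamp (p ord0 k))); split; first exact: (clamp_angles (p ord0)).
apply/eqP; rewrite eq_le; apply/andP; split; last first.
  by apply: interval_min_le => //; exact: (clamp_angles (p ord0)).
apply: (@interval_norm_acos_le a b n (p ord0)) => // u hu; rewrite leNgt; apply/negP => lt.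
pose g (q : 'rV[R]_n) := `|weight a b u * \prod_(k < n) (u - q ord0 k)|.
have cg : continuous g.
  move=> q; apply: (@continuous_comp 'rV[R]_n R R
    (fun q => weight a b u * \prod_(k < n) (u - q ord0 k)) (fun v => `|v|));
    last exact: norm_continuous.
  apply: (@cvgM _ _ (nbhs q) _ (cst (weight a b u))); first exact: cvg_cst.
  apply: (@cvg_big R 'I_n *%R 1 predT (@mul_continuous R) _ (nbhs q) _
    (fun k (q : 'rV[R]_n) => u - q ord0 k) (fun k => u - q ord0 k)) => k _.
  apply: (@cvgB _ _ _ (nbhs q) _ (cst u)); first exact: cvg_cst.
  exact: coord_continuous.
have lt' : interval_min a b n < (interval_min a b n + g p) / 2 < g p.
  by rewrite /g; apply/andP; split; lra.
have nb : nbhs p [set q | (interval_min a b n + g p) / 2 < g q].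
  by apply: (@cvgr_gt _ _ (nbhs p) _ g (g p) (cg p)); case/andP: lt'.
(* From index N on, the slack 1/(m+1) of the minimizing sequence is less than half of the supposed
   excess of [g p] over the minimum. *)
pose N := Num.trunc ((interval_min a b n + g p) / 2 - interval_min a b n)^-1.
have tail : (v @ \oo) [set v m | m in [set m | (N <= m)%N]].
  by exists N => // m Nm; exists m.
have [q [[m Nm <-] /= hm]] := hp _ _ tail nb.
have : g (v m) <= interval_norm a b (T m).
  have [_ [_ _ h]] := interval_normP a0 b0 (erefl (\prod_(k < n) ('X - (cos (T m k))%:P))).
  apply: le_trans (h u hu); rewrite horner_prod /g.
  rewrite (eq_bigr (fun k => ('X - (cos (T m k))%:P).[u])) // => k _.
  by rewrite hornerXsubC mxE.
move=> gT; have Tm := hT m.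
suff : m.+1%:R^-1 < (interval_min a b n + g p) / 2 - interval_min a b n.
  move=> h; have := lt_trans hm (le_lt_trans gT Tm).
  by rewrite -ltrBlDl => /(lt_trans h); rewrite ltxx.
have d0 : 0 < (interval_min a b n + g p) / 2 - interval_min a b n.
  by rewrite subr_gt0; case/andP: lt'.
rewrite -[ltRHS]invrK ltf_pV2 ?posrE ?invr_gt0 //.
by apply: lt_le_trans (truncnS_gt _) _; rewrite ler_nat ltnS.
Qed.

End IntervalMin.

(** * Alternation: the minimum is attained on every gap between roots *)

Section Alternation.
Context {R : realType}.
Implicit Types (a b u M : R) (f g h : {poly R}).

(** On [lo,hi] the change is at most K c, with c chosen so that K c < M - M'. Elsewhere g > 0: if g
    >= c, subtracting c strictly lowers a nonzero modulus, and if g < c the new modulus is at most K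
    c. *)
Lemma weight_poly_perturb a b g h (lo hi M : R) : 0 <= a -> 0 <= b ->
    -1 <= lo -> lo <= hi -> hi <= 1 -> 0 < M ->
    (forall u, -1 <= u <= 1 -> `|weight a b u * (h * g).[u]| <= M) ->
    (forall u, lo <= u <= hi -> `|weight a b u * (h * g).[u]| < M) ->
    (forall u, -1 <= u <= 1 -> u < lo \/ hi < u -> 0 < g.[u]) ->
  exists2 c, 0 < c &
    forall u, -1 <= u <= 1 -> `|weight a b u * (h * (g - c%:P)).[u]| < M.
Proof.
move=> a0 b0 hlo lohi hhi M0 le_M lt_M g0.
have [v hv vmax] := weight_poly_max (h * g) a0 b0 hlo lohi hhi.
have [|||w hw wmax] := @weight_poly_max _ a b h (-1) 1 a0 b0; try by lra.
set M' := `|_ * (h * g).[v]| in vmax; set K := `|_ * h.[w]| in wmax.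
have M'M : M' < M by exact: lt_M.
have M'0 : 0 <= M' by exact: normr_ge0.
have K0 : 0 <= K by exact: normr_ge0.
pose c := (M - M') / (2 * (K + 1)).
have c0 : 0 < c by apply: divr_gt0; lra.
have Kc : K * c < M - M'.
  rewrite /c mulrA ltr_pdivrMr; last by lra.
  by rewrite mulrC ltr_pM2l; lra.
exists c => // u hu.
have -> : weight a b u * (h * (g - c%:P)).[u]
    = weight a b u * h.[u] * g.[u] - weight a b u * h.[u] * c.
  by rewrite !(hornerM, hornerD, hornerN, hornerC); ring.
have hc : `|weight a b u * h.[u] * c| <= K * c.
  by rewrite normrM (gtr0_norm c0) ler_pM2r // wmax.
case: (boolP (lo <= u <= hi)) => [uI|uI].
  have := vmax u uI; rewrite hornerM mulrA => h1.
  by apply: le_lt_trans (ler_normB _ _) _; lra.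
have {}g0 : 0 < g.[u].
  apply: g0 => //; move: uI; rewrite negb_and -!ltNge.
  by case/orP; [left|right].
have [gc|gc] := leP c g.[u]; last first.
  rewrite -mulrBr normrM (le_lt_trans (y := K * c)) //; last by lra.
  apply: ler_pM => //; first by rewrite wmax.
  by rewrite ler0_norm; lra.
have := le_M u hu; rewrite hornerM mulrA normrM (gtr0_norm g0) => h1.
rewrite -mulrBr normrM (@ger0_norm _ (_ - c)); last by lra.
have [->|h2] := eqVneq (weight a b u * h.[u]) 0; first by rewrite normr0 mul0r.
by apply: lt_le_trans h1; rewrite ltr_pM2l ?normr_gt0 //; lra.
Qed.

(* The roots s 0 <= ... <= s (n - 1) of a minimizer, extended by -1 and 1. *)
Definition gap_lo (s : nat -> R) i : R := if i is j.+1 then s j else -1.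
Definition gap_hi n (s : nat -> R) i : R := if (i < n)%N then s i else 1.

Lemma root_poly_set n (s : nat -> R) i (v : R) : (i <= n)%N ->
  root_poly n.+1 (fun j => if j == i then v else s j)
    = root_poly n (s \o bump i) * ('X - v%:P).
Proof.
move=> ni; rewrite (root_polyE _ ni) /= eqxx mulrC; congr (_ * _).
by apply: eq_bigr => j _ /=; rewrite eq_sym (negbTE (neq_bump _ _)).
Qed.

(** If gap i missed the value M, one could widen it by subtracting a small constant from the factor
    g carrying its end roots, and so get a norm below the minimum. The new roots may leave [-1,1],
    which [interval_min_le_roots] permits. *)
Lemma alternation a b n (s : nat -> R) M : 0 <= a -> 0 <= b -> (0 < n)%N ->
    (forall i j, (i <= j < n)%N -> s i <= s j) ->
    (forall i, (i < n)%N -> -1 <= s i <= 1) ->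
    M = interval_min a b n -> 0 < M ->
    (forall u, -1 <= u <= 1 -> `|weight a b u * (root_poly n s).[u]| <= M) ->
  forall i, (i <= n)%N -> exists2 u, gap_lo s i <= u <= gap_hi n s i &
    `|weight a b u * (root_poly n s).[u]| = M.
Proof.
move=> a0 b0 n0 smon sI ME M0 le_M i ni; apply: contrapT => nomax.
have lo1 : -1 <= gap_lo s i.
  by case: i ni {nomax} => // i /sI /andP[].
have hi1 : gap_hi n s i <= 1.
  by rewrite /gap_hi; case: ltnP => // /sI /andP[].
have lohi : gap_lo s i <= gap_hi n s i.
  rewrite /gap_hi; case: ltnP => hin; case: i ni hin {nomax lo1 hi1} => [|i] ni hin //=.
  - by case/andP: (sI _ hin).
  - by apply: smon; rewrite leqnSn.
  - by case/andP: (sI _ ni).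
have lt_M u : gap_lo s i <= u <= gap_hi n s i -> `|weight a b u * (root_poly n s).[u]| < M.
  move=> hu; rewrite lt_neqAle; apply/andP; split.
    by apply/eqP => e; apply: nomax; exists u.
  by apply: le_M; lra.
(* It is enough to find g, positive outside the gap, for which g - c keeps real roots. The sign
   serves the last gap, where g = s_(n-1) - X. *)
suff [g [h [Eh gpos new]]] : exists g h, [/\ root_poly n s = h * g \/ root_poly n s = - (h * g),
    (forall u, -1 <= u <= 1 -> u < gap_lo s i \/ gap_hi n s i < u -> 0 < g.[u]) &
    forall c, 0 < c -> exists s', root_poly n s' = h * (g - c%:P) \/ root_poly n s' = - (h * (g - c%:P))].
  have E u : `|weight a b u * (root_poly n s).[u]| = `|weight a b u * (h * g).[u]|.
    by case: Eh => ->; rewrite ?hornerN ?mulrN ?normrN.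
  have [||c c0 ltc] := @weight_poly_perturb a b g h _ _ M a0 b0 lo1 lohi hi1 M0 _ _ gpos.
  - by move=> u; rewrite -E; exact: le_M.
  - by move=> u; rewrite -E; exact: lt_M.
  have [s' Es'] := new c c0.
  have [|||v hv vmax] := @weight_poly_max _ a b (h * (g - c%:P)) (-1) 1 a0 b0; try by lra.
  have := ltc v hv; rewrite ltNge => /negP; apply; rewrite ME.
  apply: (@interval_min_le_roots _ a b n (fun k => s' k)) => // u hu.
  apply: le_trans (vmax u hu); rewrite -horner_root_poly.
  by case: Es' => ->; rewrite ?hornerN ?mulrN ?normrN.
clear nomax lt_M le_M ME M0.
case: n n0 smon sI ni hi1 lohi => // n _ smon sI ni hi1 lohi.
case: i ni lo1 hi1 lohi => [|i] ni lo1 hi1 lohi.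
  exists ('X - (s 0%N)%:P), (root_poly n (s \o bump 0)); split.
  - by left; rewrite (root_polyE _ (leq0n n)) mulrC.
  - by move=> u hu /=; rewrite /gap_hi /= hornerXsubC; lra.
  - move=> c c0; exists (fun j => if j == 0%N then s 0%N + c else s j); left.
    by rewrite root_poly_set // rmorphD opprD addrA.
have [En|{}ni] : i = n \/ (i < n)%N by lia.
  subst i.
  exists ((s n)%:P - 'X), (root_poly n (s \o bump n)); split.
  - by right; rewrite (root_polyE _ (leqnn n)); ring.
  - move=> u hu /=; rewrite /gap_hi ltnn /= !(hornerD, hornerN, hornerC, hornerX).
    by case; lra.
  - move=> c c0; exists (fun j => if j == n then s n - c else s j); right.
    by rewrite root_poly_set // rmorphB /=; ring.
case: n smon sI ni hi1 lohi => // n smon sI ni hi1 lohi.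
pose r := (s \o bump i) \o bump i.
have sE v w : root_poly n.+2 (fun j => if j == i then v else if j == i.+1 then w else s j)
    = root_poly n r * (('X - w%:P) * ('X - v%:P)).
  rewrite root_poly_set; last by lia.
  rewrite mulrA; congr (_ * _).
  rewrite -(@root_poly_set n (s \o bump i) i w); last by lia.
  apply: eq_bigr => j _ /=; congr ('X - _%:P).
  have -> : (bump i j == i.+1) = (j == i :> nat) by rewrite /bump; case: leqP; lia.
  by [].
have sab : s i <= s i.+1 by apply: smon; lia.
have sE0 : root_poly n.+2 s = root_poly n r * (('X - (s i.+1)%:P) * ('X - (s i)%:P)).
  rewrite -sE; apply: eq_bigr => j _; congr ('X - _%:P).
  by case: eqP => [->//|_]; case: eqP => [->|].
exists (('X - (s i.+1)%:P) * ('X - (s i)%:P)), (root_poly n r); split.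
- by left.
- move=> u hu /=; rewrite /gap_hi ltnS ni hornerM !hornerXsubC => -[h|h].
    by rewrite -mulrNN mulr_gt0; lra.
  by rewrite mulr_gt0; lra.
(* For an inner gap g is quadratic, and the roots of g - c are the midpoint A of the gap plus and
   minus D. *)
- move=> c c0; set A := (s i + s i.+1) / 2; set D := Num.sqrt ((s i.+1 - s i) ^+ 2 / 4 + c).
  exists (fun j => if j == i then A - D else if j == i.+1 then A + D else s j); left.
  rewrite sE; congr (_ * _).
  have D2 : D ^+ 2 = (s i.+1 - s i) ^+ 2 / 4 + c.
    by rewrite sqr_sqrtr // addr_ge0 ?(ltW c0) // divr_ge0 // sqr_ge0.
  have -> : c = D ^+ 2 - (s i.+1 - s i) ^+ 2 / 4 by rewrite D2; ring.
  have hA : s i.+1 = 2 * A - s i by rewrite /A; field.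
  rewrite hA; have -> : D ^+ 2 - (2 * A - s i - s i) ^+ 2 / 4 = D ^+ 2 - (A - s i) ^+ 2 by field.
  rewrite !(rmorphB, rmorphD, rmorphM, rmorphXn) /=; ring.
Qed.

End Alternation.

(** * Structure and uniqueness of the interval minimizer *)

Section MinimizerStructure.
Context {R : realType}.
Implicit Types (a b u : R).

Lemma interlaced_cell n (x y : nat -> R) u : interlaced n x y ->
  exists2 i, (i <= n)%N &
    (forall j, (j < i)%N -> y j <= u) /\ (forall j, (i <= j < n)%N -> u <= y j).
Proof.
move=> xy; have ex : exists i, (i == n) || (u <= y i) by exists n; rewrite eqxx.
case: (ex_minnP ex) => i hi imin.
have ni : (i <= n)%N by apply: imin; rewrite eqxx.
exists i => //; split => j.
  move=> ji; rewrite leNgt; apply/negP => /ltW uy.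
  by have := imin j; rewrite uy orbT leqNgt ji => /(_ isT).
case/andP=> ij jn; case/orP: hi => [/eqP e|ui].
  by move: jn; rewrite -e ltnNge ij.
move: ij; rewrite leq_eqVlt => /orP[/eqP<-//|ij].
have [|_ [_ h]] := @interlaced_lt _ n x y i j xy; first by rewrite ij ltnW.
apply: (le_trans ui (le_trans h _)).
have /andP[_ h1] := xy j.-1 (leq_ltn_trans (leq_pred j) jn).
rewrite prednK ?(leq_ltn_trans _ ij) // in h1.
by have /andP[h2 _] := xy j jn; apply/ltW/(lt_trans h1).
Qed.

(** Otherwise a monic polynomial of degree n would vanish at the n+1 points j/(n+2), j = 1, ...,
    n+1. *)
Lemma interval_norm_gt0 a b n (t : 'I_n -> R) : 0 <= a -> 0 <= b ->
  0 < interval_norm a b t.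
Proof.
move=> a0 b0; set f := \prod_(k < n) ('X - (cos (t k))%:P).
have [c [_ _ hmax]] := interval_normP a0 b0 (erefl f).
rewrite lt_neqAle interval_norm_ge0 // andbT eq_sym; apply/eqP => N0.
have f0 u : -1 < u < 1 -> f.[u] = 0.
  move=> hu; have hu' : -1 <= u <= 1 by case/andP: hu => /ltW-> /ltW->.
  have := hmax u hu'; rewrite N0 normr_le0 mulf_eq0 gt_eqF ?weight_gt0 //=.
  by move/eqP.
have fm : f \is monic by apply: monic_prod => k _; exact: monicXsubC.
set rs : seq R := [seq j.+1%:R / n.+2%:R | j <- iota 0 n.+1].
have := @max_poly_roots _ f rs (monic_neq0 fm).
have -> : size f = n.+1.
  rewrite /f -big_enum size_prod_XsubC -cardE; congr _.+1.
  by rewrite -[RHS]card_ord; exact: eq_card.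
rewrite size_map size_iota ltnn => H; suff : false by []; apply: H; rewrite {}/rs.
  apply/allP => _ /mapP[j + ->]; rewrite mem_iota add0n => /andP[_ jn].
  apply/eqP/f0; rewrite (lt_trans (y := 0)) ?divr_gt0 //=.
  by rewrite ltr_pdivrMr // mul1r ltr_nat ltnS.
rewrite map_inj_uniq ?iota_uniq // => i j /(mulIf _) h.
have /eqP := h (invr_neq0 (lt0r_neq0 (ltr0Sn _ _))).
by rewrite eqr_nat eqSS => /eqP.
Qed.

(** The alternation points avoid the roots and the endpoints -1 and 1, since the weighted product
    vanishes there while M > 0; hence the interlacing is strict. *)
Lemma minimizer_structure a b n (t : 'I_n -> R) :
    2^-1 <= a -> 2^-1 <= b -> (0 < n)%N -> interval_minimizer a b t ->
  exists x s : nat -> R,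
    [/\ root_poly n s = \prod_(k < n) ('X - (cos (t k))%:P),
        [/\ interlaced n x s, -1 < x 0%N & x n < 1],
        jacobi_deriv a b (root_poly n s) = - (a + b + n%:R) *: root_poly n.+1 x,
        forall i, (i <= n)%N ->
          `|weight a b (x i) * (root_poly n s).[x i]| = interval_min a b n
      & forall u, -1 <= u <= 1 ->
          weight (2 * a - 1) (2 * b - 1) u * (energy n x s).[u]
            <= interval_min a b n ^+ 2].
Proof.
move=> ha hb n0 [_ tmin]; set M := interval_min a b n.
have a0 : 0 < a by lra. have b0 : 0 < b by lra.
set f := \prod_(k < n) ('X - _).
have M0 : 0 < M by rewrite /M -tmin interval_norm_gt0 // ltW.
pose S := sort <=%R [seq cos (t k) | k <- enum 'I_n].
pose s j := nth 1 S j.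
have szS : size S = n by rewrite size_sort size_map size_enum_ord.
have Pf : root_poly n s = f.
  rewrite /root_poly -(big_mkord xpredT (fun j => 'X - (s j)%:P)) -{1}szS.
  rewrite -(big_nth 1 xpredT (fun z => 'X - z%:P)).
  by rewrite (perm_big [seq cos (t k) | k <- enum 'I_n]) ?perm_sort // big_map big_enum.
have smon i j : (i <= j < n)%N -> s i <= s j.
  case/andP=> ij jn; apply: (sorted_leq_nth le_trans le_refl) => //.
  - by apply: sort_sorted; exact: le_total.
  - by rewrite inE szS (leq_ltn_trans ij).
  - by rewrite inE szS.
have sI i : (i < n)%N -> -1 <= s i <= 1.
  move=> hi; have : s i \in S by rewrite mem_nth ?szS.
  by rewrite mem_sort => /mapP[k _ ->]; rewrite cos_geN1 cos_le1.
have le_M u : -1 <= u <= 1 -> `|weight a b u * (root_poly n s).[u]| <= M.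
  by rewrite Pf /M -tmin; have [c [_ _ h]] := interval_normP (ltW a0) (ltW b0) (erefl f); exact: h.
have alt := alternation (ltW a0) (ltW b0) n0 smon sI erefl M0 le_M.
have /choice[x hx] : forall i, exists u, (i <= n)%N -> gap_lo s i <= u <= gap_hi n s i /\
    `|weight a b u * (root_poly n s).[u]| = M.
  move=> i; have [ni|_] := leqP i n; last by exists 0.
  by have [u h1 h2] := alt i ni; exists u.
have xM i : (i <= n)%N -> `|weight a b (x i) * (root_poly n s).[x i]| = M by move=> /hx[].
have wx i : (i <= n)%N -> weight a b (x i) != 0 /\ (root_poly n s).[x i] != 0.
  move=> ni; have : 0 < `|weight a b (x i) * (root_poly n s).[x i]| by rewrite xM.
  by rewrite normr_gt0 mulf_eq0 negb_or => /andP.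
have xs_neq i j : (i <= n)%N -> (j < n)%N -> x i != s j.
  move=> ni nj; have [_] := wx i ni; apply: contraNneq => ->.
  by rewrite horner_root_poly (bigD1 (Ordinal nj)) //= subrr mul0r.
have xs : interlaced n x s.
  move=> j jn; apply/andP; split.
    have [/andP[_]] := hx j (ltnW jn); rewrite /gap_hi jn le_eqVlt => /orP[/eqP e|//].
    by have := xs_neq j j (ltnW jn) jn; rewrite e eqxx.
  have [/andP[+ _]] := hx j.+1 jn; rewrite /= le_eqVlt => /orP[/eqP e|//].
  by have := xs_neq j.+1 j jn jn; rewrite e eqxx.
have xlo : -1 < x 0%N.
  have [/andP[+ _] _] := hx 0%N (leq0n n); rewrite /= le_eqVlt => /orP[/eqP e|//].
  have [] := wx 0%N (leq0n n).
  by rewrite -e /weight subrr powR0 ?mulr0 ?eqxx // gt_eqF.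
have xhi : x n < 1.
  have [/andP[_ +] _] := hx n (leqnn n); rewrite /gap_hi ltnn le_eqVlt => /orP[/eqP e|//].
  have [] := wx n (leqnn n).
  by rewrite e /weight subrr powR0 ?mul0r ?eqxx // gt_eqF.
have xI i : (i <= n)%N -> -1 < x i < 1.
  move=> ni; apply/andP; split.
    apply: (lt_le_trans xlo); case: i ni => // i ni.
    by apply/ltW/(interlaced_incr xs).
  apply: le_lt_trans xhi; move: ni; rewrite leq_eqVlt => /orP[/eqP->//|ni].
  by apply/ltW/(interlaced_incr xs); rewrite ni leqnn.
have xI' i : (i <= n)%N -> -1 <= x i <= 1 by move=> /xI/andP[/ltW-> /ltW->].
(* The left side has degree at most n+1 and vanishes at the n+1 critical points x_i, so only its
   leading coefficient is to be found. *)
have jac : jacobi_deriv a b (root_poly n s) = - (a + b + n%:R) *: root_poly n.+1 x.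
  have szP : (size (root_poly n s) <= n.+1)%N by rewrite size_root_poly.
  rewrite [LHS](@root_poly_scale _ n.+1 x).
  - have /monicP := root_poly_monic n s; rewrite lead_coefE size_root_poly /= => lead.
    by rewrite (coef_jacobi_deriv _ _ szP) // eqxx lead mulr1.
  - exact: interlaced_inj xs.
  - move=> j jn; apply: weight_poly_extremum a0 b0 (xI j jn) _ _.
      by case: (wx j jn).
    by move=> u /andP[/ltW h1 /ltW h2]; rewrite xM // le_M // h1.
  - exact: size_jacobi_deriv.
(* At x_i the square of p drops out of the energy, and what remains is the square of the weighted
   polynomial. *)
have Ex i : (i <= n)%N ->
    weight (2 * a - 1) (2 * b - 1) (x i) * (energy n x s).[x i] = M ^+ 2.
  move=> ni; rewrite -(xM i ni) real_normK ?num_real // exprMn weight_sqr ?xI' //.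
  rewrite /energy !(hornerXn, horner_exp, hornerD, hornerN, hornerM, hornerC).
  have -> : (root_poly n.+1 x).[x i] = 0.
    by rewrite horner_root_poly (bigD1 (Ordinal (ni : (i < n.+1)%N))) //= subrr mul0r.
  by ring.
(* Rolle between two equal values M^2 gives a zero of p times the cofactor. As p has no zero
   strictly between x_j and x_(j+1), it is a zero of the cofactor. *)
have /choice[y hy] : forall j, exists v, (j < n)%N ->
    x j < v < x j.+1 /\ (energy_cofactor a b n x s).[v] = 0.
  move=> j; have [jn|_] := ltnP j n; last by exists 0.
  have /andP[h1 h2] := xs j jn.
  have [||||||v hv] := @weight_poly_rolle _ (2 * a - 1) (2 * b - 1) (energy n x s) (x j) (x j.+1).
  - by lra.
  - by lra.
  - by case/andP: (xI' j (ltnW jn)).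
  - exact: lt_trans h1 h2.
  - by case/andP: (xI' j.+1 jn).
  - by rewrite !Ex // ltnW.
  rewrite (jacobi_deriv_energy jac) hornerM => /eqP; rewrite mulf_eq0 => /orP[|/eqP e]; last by exists v.
  rewrite horner_root_poly prodf_seq_eq0 /= => /hasP[k _ /=]; rewrite subr_eq0 => /eqP vk.
  have /andP[v1 v2] := hv; have kn := ltn_ord k.
  have [kj|jk] := leqP k j.
    have : x k <= x j.
      by move: kj; rewrite leq_eqVlt => /orP[/eqP->//|kj]; apply/ltW/(interlaced_incr xs); rewrite kj ltnW.
    by rewrite -vk leNgt v1.
  have : x j.+1 <= x k.
    by move: jk; rewrite leq_eqVlt => /orP[/eqP->//|jk]; apply/ltW/(interlaced_incr xs); rewrite jk.
  by rewrite -vk leNgt v2.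
exists x, s; split => // u hu.
have xy : interlaced n x y by move=> j /hy[].
have [i ni [lo hi]] := interlaced_cell u xy.
by rewrite -(Ex i ni); apply: (energy_le ha hb xy) => // j /hy[].
Qed.

Lemma extremal_unique a b n (x s : nat -> R) (g : {poly R}) :
    interlaced n x s -> (forall i, (i <= n)%N -> -1 < x i < 1) ->
    g \is monic -> size g = n.+1 ->
    (forall i, (i <= n)%N -> `|weight a b (x i) * g.[x i]| <= `|weight a b (x i) * (root_poly n s).[x i]|) ->
  g = root_poly n s.
Proof.
move=> xs xI gm szg le; apply: (@lagrange_extremal_real _ _ (fun i : 'I_n.+1 => x i)).
- move=> i j /(interlaced_inj xs); rewrite !inE !ltn_ord => /(_ isT isT).
  exact: val_inj.
- exact: root_poly_monic.
- by [].
- by rewrite size_root_poly card_ord.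
- by rewrite szg card_ord.
- by move=> i; apply: (interlaced_pos xs); rewrite -ltnS.
- move=> i; have := le i (ltnSE (ltn_ord i)).
  rewrite 2!(normrM (weight _ _ _)) ler_pM2l // normr_gt0 gt_eqF // weight_gt0 //.
  by rewrite xI // -ltnS.
Qed.

End MinimizerStructure.

(** * The lift of a polynomial from the interval to the circle *)

(* The polynomial (2 z)^n P((z + z^-1) / 2) for P with roots c. *)
Definition joukowski_lift {F : nzRingType} n (c : nat -> F) : {poly F} :=
  \prod_(k < n) ('X^2 - (2 * c k)%:P * 'X + 1).

Section JoukowskiLift.
Context {F : fieldType}.
Implicit Types (c : nat -> F) (U V : F).

(* U and V stand for cos and i sin of the argument of a point of the circle. *)
Lemma horner_joukowski_lift n c U V : U ^+ 2 - V ^+ 2 = 1 ->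
  (joukowski_lift n c).[U + V] = (2 * (U + V)) ^+ n * (root_poly n c).[U].
Proof.
move=> UV; rewrite /joukowski_lift /root_poly.
elim: n => [|n IH]; first by rewrite !big_ord0 !hornerE.
rewrite !big_ord_recr /= !hornerM IH (exprS (2 * _)).
rewrite !(hornerXn, hornerD, hornerN, hornerM, hornerC, hornerX).
rewrite [X in _ * X](_ : _ = 2 * (U + V) * (U - c n)); first by ring.
by rewrite -[X in _ + X = _]UV; ring.
Qed.

(** Here z = U + V has inverse U - V, so U = (z + 1/z)/2 and z dU/dz = V; the formula is z d/dz
    applied to (2z)^n P(U). *)
Lemma deriv_joukowski_lift n c U V : U ^+ 2 - V ^+ 2 = 1 ->
  (U + V) * (joukowski_lift n c)^`().[U + V]
    = (2 * (U + V)) ^+ n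
      * (n%:R * (root_poly n c).[U] + V * (root_poly n c)^`().[U]).
Proof.
move=> UV; elim: n => [|n IH].
  by rewrite /joukowski_lift /root_poly !big_ord0 -polyC1 derivC !horner0; ring.
have lE : joukowski_lift n.+1 c = joukowski_lift n c * ('X^2 - (2 * c n)%:P * 'X + 1).
  by rewrite /joukowski_lift big_ord_recr.
have rE : root_poly n.+1 c = root_poly n c * ('X - (c n)%:P).
  by rewrite /root_poly big_ord_recr.
have dq : ('X^2 - (2 * c n)%:P * 'X + 1)^`() = 'X *+ 2 - (2 * c n)%:P :> {poly F}.
  have d1 : 1^`() = 0 :> {poly F} by rewrite -polyC1 derivC.
  rewrite !(derivD, derivN, derivXn, derivM, derivC, derivX, d1) /=; ring.
rewrite lE rE !derivM dq derivXsubC.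
rewrite !(hornerXn, hornerD, hornerN, hornerM, hornerMn, hornerC, hornerX) mulrDr mulrA IH.
rewrite (horner_joukowski_lift n c UV) (exprS (2 * _)) -natr1.
have -> : (U + V) ^+ 2 - 2 * c n * (U + V) + 1 = 2 * (U + V) * (U - c n).
  by rewrite -[X in _ + X = _]UV; ring.
by ring.
Qed.

Lemma joukowski_factor_monic (d : F) : 'X^2 - d%:P * 'X + 1 \is monic /\
  size ('X^2 - d%:P * 'X + 1) = 3.
Proof.
have sz : size ('X^2 - d%:P * 'X + 1) = 3.
  rewrite -addrA size_polyDl size_polyXn // (leq_ltn_trans (size_polyD _ _)) //.
  rewrite gtn_max size_polyN size_poly1 andbT mul_polyC.
  by rewrite (leq_ltn_trans (size_scale_leq _ _)) // size_polyX.
by split => //; rewrite monicE lead_coefE sz coefD coefB coefXn coefCM coefX coef1 mulr0 subr0 addr0.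
Qed.

Lemma joukowski_lift_monic n c : joukowski_lift n c \is monic.
Proof. by apply: monic_prod => k _; have [] := joukowski_factor_monic (2 * c k). Qed.

Lemma size_joukowski_lift n c : size (joukowski_lift n c) = n.*2.+1.
Proof.
rewrite /joukowski_lift; elim: n => [|n IH]; first by rewrite big_ord0 size_poly1.
have [m sz] := joukowski_factor_monic (2 * c n).
rewrite big_ord_recr /= size_Mmonic //; last first.
  by rewrite -size_poly_gt0 IH.
by rewrite IH sz doubleS addnC.
Qed.

End JoukowskiLift.

(** * The polynomial factor of the normalized derivative *)

Section DerivFactor.
Context {R : realType}.
Implicit Types (a b : R) (L : {poly R[i]}).

(** The three summands contribute 2a, 2b and 2n to the leading coefficient, which the normalization
    divides out. *)
Lemma deriv_factor_monic a b n L : L \is monic -> size L = n.*2.+1 ->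
    0 < 2 * a + 2 * b + 2 * n%:R ->
  let Q := ((2 * a + 2 * b + 2 * n%:R)^-1)%:C *: deriv_factor a b L in
  Q \is monic /\ size Q = n.*2.+2.
Proof.
move=> /monicP; rewrite lead_coefE => lead szL N0 Q; rewrite szL /= in lead.
have L0 k : (n.*2 < k)%N -> L`_k = 0 by move=> h; rewrite nth_default // szL.
have Qk k : (n.*2 < k)%N -> Q`_k = (k == n.*2.+1)%:R.
  move=> nk.
  have -> : Q = ((2 * a + 2 * b + 2 * n%:R)^-1)%:C *:
     ((2 * a)%:C *: ('X * L + L) + (2 * b)%:C *: ('X * L - L) + ('X^2 * L^`() - L^`())).
    by rewrite /Q /deriv_factor !mulrDl mul1r !mulNr !mul1r.
  case: k nk => // k; rewrite ltnS => nk.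
  rewrite !(coefZ, coefD, coefB, coefN) (coefXnM 2 L^`()) !coefXM !coef_deriv /=.
  rewrite (L0 k.+1) // (L0 k.+2 (leqW nk)).
  have -> : (if (k.+1 < 2)%N then 0 else L`_(k.+1 - 2).+1 *+ (k.+1 - 2).+1) = L`_k *+ k.
    by case: k {nk} => [|k] //=; rewrite subSS subSS subn0.
  rewrite mul0rn eqSS; have [->|kn] := eqVneq k n.*2.
    rewrite lead addr0 !subr0 !mulr1 -rmorphD /=.
    transitivity (((2 * a + 2 * b + 2 * n%:R)^-1 * (2 * a + 2 * b + n.*2%:R))%:C).
      by rewrite rmorphM (rmorphD _ (2 * a + 2 * b)) rmorph_nat.
    by rewrite -mul2n natrM mulVf ?gt_eqF.
  rewrite L0; last by rewrite ltn_neqAle eq_sym kn.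
  by rewrite mul0rn !addr0 !subr0 !mulr0 !addr0 mulr0.
have szQ : size Q = n.*2.+2.
  apply/eqP; rewrite eqn_leq; apply/andP; split.
    by apply/leq_sizeP => k hk; rewrite Qk ?gtn_eqF //; exact: leq_trans hk.
  by rewrite ltnNge; apply/negP => /leq_sizeP/(_ _ (leqnn _))/eqP; rewrite Qk // eqxx oner_eq0.
by split => //; rewrite monicE lead_coefE szQ /= Qk // eqxx.
Qed.

Lemma normc_sqr (x y : R) : Normc.normc (x +i* y) ^+ 2 = x ^+ 2 + y ^+ 2.
Proof. by rewrite /= sqr_sqrtr // addr_ge0 // sqr_ge0. Qed.

(** With V = iv one has z^2 - 1 = 2 V z and V^2 = u^2 - 1. After removing 2 (2z)^n from the
    unnormalized factor, the imaginary part is (a+b+n) v P, and the real part is minus the left side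
    of the critical point equation, that is (a+b+n) p. *)
Lemma horner_deriv_factor_circle a b n (x s : nat -> R) (u v : R) :
    u ^+ 2 + v ^+ 2 = 1 -> 0 < 2 * a + 2 * b + 2 * n%:R ->
    jacobi_deriv a b (root_poly n s) = - (a + b + n%:R) *: root_poly n.+1 x ->
  (((2 * a + 2 * b + 2 * n%:R)^-1)%:C
     *: deriv_factor a b (joukowski_lift n (fun k => (s k)%:C))).[u +i* v]
  = (2 * (u +i* v)) ^+ n * ((root_poly n.+1 x).[u] +i* (v * (root_poly n s).[u])).
Proof.
move=> uv N0 jac.
set c := fun k => (s k)%:C.
pose U : R[i] := u%:C; pose V : R[i] := 'i * v%:C.
have zE : u +i* v = U + V by rewrite [LHS]complexE.
have i2 : 'i ^+ 2 = -1 :> R[i] by exact: sqr_i.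
have V2 : V ^+ 2 = - (v ^+ 2)%:C by rewrite exprMn i2 rmorphXn /= mulN1r.
have UV : U ^+ 2 - V ^+ 2 = 1.
  by rewrite V2 opprK /U -rmorphXn -rmorphD /= uv.
have rE : root_poly n c = map_poly (real_complex R) (root_poly n s).
  rewrite rmorph_prod; apply: eq_bigr => j _.
  by rewrite rmorphB /= map_polyX map_polyC.
set P := (root_poly n s).[u]; set P' := (root_poly n s)^`().[u]; set p := (root_poly n.+1 x).[u].
have PC : (root_poly n c).[U] = P%:C by rewrite rE horner_map.
have PC' : (root_poly n c)^`().[U] = P'%:C by rewrite rE deriv_map horner_map.
have L1 := horner_joukowski_lift n c UV; have L2 := deriv_joukowski_lift n c UV.
have J : (b * (1 - u) - a * (1 + u)) * P + (1 - u ^+ 2) * P' = - (a + b + n%:R) * p.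
  have := congr1 (fun f : {poly R} => f.[u]) jac.
  by rewrite /jacobi_deriv !(hornerXn, hornerD, hornerN, hornerM, hornerC, hornerX, hornerZ).
rewrite hornerZ [X in X%:C * _](_ : _ = (2 * (a + b + n%:R))^-1); last by congr (_^-1); ring.
rewrite zE /deriv_factor !(hornerXn, horner_exp, hornerD, hornerN, hornerM, hornerC, hornerX, hornerZ).
have -> : (U + V) ^+ 2 - 1 = 2 * V * (U + V) by rewrite -[X in _ - X = _]UV; ring.
rewrite -[2 * V * (U + V) * _]mulrA L2 L1 PC PC'.
have -> : p +i* (v * P) = p%:C + V * P%:C.
  by rewrite [LHS]complexE /= (rmorphM _ v) /= mulrA.
have k0 : (a + b + n%:R)%:C != 0 :> R[i].
  by rewrite (fmorph_eq0 (real_complex R)) gt_eqF //; lra.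
have JC : (b%:C * (1 - U) - a%:C * (1 + U)) * P%:C + (1 - U ^+ 2) * P'%:C = - (a + b + n%:R)%:C * p%:C.
  have := congr1 (real_complex R) J.
  by rewrite !(rmorphD, rmorphM, rmorphB, rmorphN, rmorphXn, rmorph1) /=.
have V2' : V ^+ 2 = U ^+ 2 - 1.
  by rewrite -UV; ring.
have K0 : 2 * (a + b + n%:R)%:C != 0 :> R[i] by rewrite mulf_neq0 // pnatr_eq0.
rewrite fmorphV !rmorphM !rmorph_nat /=.
apply: (mulfI K0); rewrite mulVKf //.
move: JC; rewrite !rmorphD rmorph_nat /=.
move: (a%:C) (b%:C) (n%:R) (_ ^+ n) (P%:C) (P'%:C) (p%:C) V2' => A B N W P1 P2 P3 V2' JC.
transitivity (2 * W * (V * (A + B + N) * P1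
  - ((B * (1 - U) - A * (1 + U)) * P1 - V ^+ 2 * P2))); first by ring.
rewrite V2'.
have -> : (B * (1 - U) - A * (1 + U)) * P1 - (U ^+ 2 - 1) * P2 = - (A + B + N) * P3.
  by rewrite -JC; ring.
by ring.
Qed.

End DerivFactor.

(** * Values on the circle and extremality of the candidate *)

Section Circle.
Context {R : realType}.
Implicit Types (a b u v : R) (z : R[i]) (g : {poly R[i]}).

Definition circle_value a b g z : R :=
  Normc.normc (z - 1) `^ (2 * a - 1) * Normc.normc (z + 1) `^ (2 * b - 1)
  * Normc.normc g.[z].

Lemma normc_ge0 z : 0 <= Normc.normc z.
Proof. by case: z => x y; exact: sqrtr_ge0. Qed.

Lemma circle_value_ge0 a b g z : 0 <= circle_value a b g z.
Proof. by rewrite /circle_value !mulr_ge0 ?powR_ge0 ?normc_ge0. Qed.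

Lemma normcX z n : Normc.normc (z ^+ n) = Normc.normc z ^+ n.
Proof. by elim: n => [|n IH]; rewrite ?expr0 ?Normc.normc1 // !exprS Normc.normcM IH. Qed.

Lemma normcE z : `|z| = (Normc.normc z)%:C.
Proof. by []. Qed.

(** Uses |z-1|^2 = 2(1-u) and |z+1|^2 = 2(1+u); the powers of 2 are 2a-1, 2b-1 and 2n, hence the
    constant. *)
Lemma circle_value_sqr a b g n (x s : nat -> R) u v : u ^+ 2 + v ^+ 2 = 1 ->
    g.[u +i* v] = (2 * (u +i* v)) ^+ n
      * ((root_poly n.+1 x).[u] +i* (v * (root_poly n s).[u])) ->
  circle_value a b g (u +i* v) ^+ 2 = (2 `^ (n%:R + a + b - 1)) ^+ 2
    * (weight (2 * a - 1) (2 * b - 1) u * (energy n x s).[u]).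
Proof.
move=> uv gE; have u1 : `|u| <= 1.
  by rewrite -(ler_pXn2r (_ : (0 < 2)%N)) ?nnegrE // real_normK ?num_real // expr1n -uv lerDl sqr_ge0.
have /andP[hu1 hu2] : -1 <= u <= 1 by rewrite -ler_norml.
have v2 : v ^+ 2 = 1 - u ^+ 2 by rewrite -uv; ring.
have pw c w : 0 <= w -> (w `^ c) ^+ 2 = (w ^+ 2) `^ c by move=> w0; rewrite !expr2 powRM.
have -> : (2 `^ (n%:R + a + b - 1)) ^+ 2 = 2 `^ (2 * a - 1) * 2 `^ (2 * b - 1) * (2 ^+ n) ^+ 2.
  rewrite -(@powR_mulrn _ 2 n) // !expr2 -!powRD ?pnatr_eq0 ?implybT //.
  by congr (_ `^ _); ring.
rewrite /circle_value !exprMn !pw ?normc_ge0 //.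
have -> : Normc.normc (u +i* v - 1) ^+ 2 = 2 * (1 - u).
  by rewrite -[1 : R[i]]/(1 +i* 0) normc_sqr subr0 v2; ring.
have -> : Normc.normc (u +i* v + 1) ^+ 2 = 2 * (1 + u).
  by rewrite -[1 : R[i]]/(1 +i* 0) normc_sqr addr0 v2; ring.
rewrite !powRM //; [|lra|lra].
have n2 : Normc.normc (2 : R[i]) = 2 by rewrite -(rmorph_nat (real_complex R)) /= expr0n addr0 sqrtr_sqr ger0_norm.
have nz : Normc.normc (u +i* v) = 1 by rewrite /= uv sqrtr1.
rewrite gE !Normc.normcM normcX Normc.normcM n2 nz mulr1 exprMn normc_sqr.
have -> : (root_poly n.+1 x).[u] ^+ 2 + (v * (root_poly n s).[u]) ^+ 2 = (energy n x s).[u].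
  rewrite exprMn v2 /energy !(hornerXn, horner_exp, hornerD, hornerN, hornerM, hornerC); ring.
by rewrite /weight; ring.
Qed.

(** The interpolation nodes: both points of the unit circle above x_i. *)
Definition circle_point (x : nat -> R) (i : nat) (e : bool) : R[i] :=
  x i +i* (if e then Num.sqrt (1 - x i ^+ 2) else - Num.sqrt (1 - x i ^+ 2)).

Lemma circle_point_sqr (x : nat -> R) i e : -1 < x i < 1 ->
  x i ^+ 2 + (complex.Im (circle_point x i e)) ^+ 2 = 1 /\ complex.Im (circle_point x i e) != 0.
Proof.
move=> /andP[h1 h2]; have h : 0 < 1 - x i ^+ 2.
  by rewrite (_ : 1 - _ = (1 - x i) * (1 + x i)); [apply: mulr_gt0; lra | ring].
have h' : Num.sqrt (1 - x i ^+ 2) ^+ 2 = 1 - x i ^+ 2 by rewrite sqr_sqrtr // ltW.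
case: e => /=; rewrite ?sqrrN h'; split; rewrite ?oppr_eq0 ?gt_eqF ?sqrtr_gt0 //; ring.
Qed.

(** Conjugate nodes have sum 2 x_i and product 1. So the nodal polynomial is the lift of p, and
    [deriv_joukowski_lift] gives its derivative at the nodes. *)
Lemma circle_point_prod n (x : nat -> R) : (forall i, (i < n)%N -> -1 < x i < 1) ->
  \prod_(q : 'I_n * bool) ('X - (circle_point x q.1 q.2)%:P)
    = joukowski_lift n (fun k => (x k)%:C).
Proof.
move=> xI; rewrite -(pair_bigA _ (fun (i : 'I_n) e => 'X - (circle_point x i e)%:P)) /=.
apply: eq_bigr => i _; rewrite big_bool /=.
set zp := circle_point x i true; set zm := circle_point x i false.
have e1 : zp + zm = 2 * (x i)%:C.
  have -> : 2 * (x i)%:C = (2 * x i)%:C by rewrite rmorphM rmorph_nat.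
  by apply/eqP; rewrite eq_complex /= addrN eqxx andbT; apply/eqP; ring.
have e2 : zp * zm = 1.
  have [h _] := circle_point_sqr true (xI i (ltn_ord i)).
  move: h; rewrite /zp /zm /circle_point /=; set r := Num.sqrt _ => h.
  apply/eqP; rewrite eq_complex /=; apply/andP.
  by split; apply/eqP; [rewrite -h|]; ring.
rewrite -e1 -[1]/(1%:P) -e2 polyCD polyCM; ring.
Qed.

(** At a node p vanishes, so Q(z) = (2z)^n V P(x_i) while the nodal derivative is (2z)^n 2 V
    p'(x_i). The quotient P(x_i) / (2 p'(x_i)) is positive by [interlaced_pos], and
    [lagrange_extremal] applies; the weight cancels because no node is 1 or -1. *)
Lemma circle_extremal a b n (x s : nat -> R) (Q B : {poly R[i]}) :
    interlaced n x s -> (forall i, (i <= n)%N -> -1 < x i < 1) ->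
    Q \is monic -> size Q = n.*2.+2 -> B \is monic -> size B = n.*2.+2 ->
    (forall u v, u ^+ 2 + v ^+ 2 = 1 -> Q.[u +i* v] = (2 * (u +i* v)) ^+ n
      * ((root_poly n.+1 x).[u] +i* (v * (root_poly n s).[u]))) ->
    (forall i e, (i <= n)%N ->
      circle_value a b B (circle_point x i e) <= circle_value a b Q (circle_point x i e)) ->
  B = Q.
Proof.
move=> xs xI Qm szQ Bm szB QE le.
have xI' i : (i < n.+1)%N -> -1 < x i < 1 by exact: xI.
have card : #|(('I_n.+1 * bool)%type : finType)| = n.*2.+2.
  by rewrite card_prod card_ord card_bool muln2.
apply: (@lagrange_extremal _ _ (fun q : 'I_n.+1 * bool => circle_point x q.1 q.2)) => //.
- move=> [i e] [j e'] /= [/(interlaced_inj xs)]; rewrite !inE !ltn_ord => /(_ isT isT)/val_inj <-.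
  have [_] := circle_point_sqr true (xI i (ltnSE (ltn_ord i))).
  rewrite /=; case: e; case: e' => //= h /eqP.
    by rewrite -addr_eq0 -mulr2n mulrn_eq0 (negbTE h).
  by rewrite eq_sym -addr_eq0 -mulr2n mulrn_eq0 (negbTE h).
- by rewrite szQ card.
- by rewrite szB card.
- move=> [i e]; rewrite (circle_point_prod xI') /=.
  have iN : (i <= n)%N by rewrite -ltnS.
  have [h v0] := circle_point_sqr e (xI i iN).
  set z := circle_point x i e in h v0 *; set v := complex.Im z in h v0.
  have zE : z = x i +i* v by [].
  pose U : R[i] := (x i)%:C; pose V : R[i] := 'i * v%:C.
  have zUV : z = U + V by rewrite zE [LHS]complexE.
  have UV : U ^+ 2 - V ^+ 2 = 1.
    by rewrite exprMn sqr_i mulN1r opprK -!rmorphXn -rmorphD /= h.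
  have rE : root_poly n.+1 (fun k => (x k)%:C) = map_poly (real_complex R) (root_poly n.+1 x).
    rewrite rmorph_prod; apply: eq_bigr => j _.
    by rewrite rmorphB /= map_polyX map_polyC.
  have px0 : (root_poly n.+1 x).[x i] = 0.
    by rewrite horner_root_poly (bigD1 i) //= subrr mul0r.
  have := deriv_joukowski_lift n.+1 (fun k => (x k)%:C) UV.
  rewrite rE deriv_map !horner_map /= px0 mulr0 add0r -zUV.
  set D := (_^`()).[z] => zD.
  rewrite zE QE // -zE px0.
  have -> : 0 +i* (v * (root_poly n s).[x i]) = V * ((root_poly n s).[x i])%:C.
    by rewrite [LHS]complexE /= (rmorphM _ v) /= mulrA add0r.
  have z0 : z != 0.
    by apply: contraNneq v0 => z0; rewrite /v z0.
  have DE : D = (2 * z) ^+ n * (2 * (V * ((root_poly n.+1 x)^`().[x i])%:C)).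
    by apply: (mulfI z0); rewrite zD (exprS (2 * z)); ring.
  have V0 : V != 0.
    by rewrite mulf_neq0 ?neq0Ci // fmorph_eq0.
  rewrite DE -mulf_div divff ?mul1r; last by rewrite expf_neq0 // mulf_neq0 // pnatr_eq0.
  rewrite mulrCA -mulf_div divff // mul1r invfM mulrCA mulr_gt0 ?invr_gt0 ?ltr0n //.
  by rewrite -fmorph_div ltcR; exact: interlaced_pos xs iN.
- move=> [i e] /=; have iN : (i <= n)%N by rewrite -ltnS.
  have [h v0] := circle_point_sqr e (xI i iN).
  have := le i e iN; rewrite /circle_value !normcE lecR ler_pM2l // mulr_gt0 //; apply: powR_gt0.
    rewrite lt_neqAle normc_ge0 andbT eq_sym; apply: contra v0 => /eqP/Normc.eq0_normc/eqP.
    by rewrite eq_complex /= subr0 => /andP[].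
  rewrite lt_neqAle normc_ge0 andbT eq_sym; apply: contra v0 => /eqP/Normc.eq0_normc/eqP.
  by rewrite eq_complex /= addr0 => /andP[].
Qed.

End Circle.

(** * Solution of the circle problem and uniqueness on the interval *)

Section CircleMin.
Context {R : realType}.
Implicit Types (a b u v : R) (z w : R[i]).

Lemma normcB_le z w : Normc.normc (z - w) <= Normc.normc z + Normc.normc w.
Proof. by have := ler_normB z w; rewrite !normcE -rmorphD lecR. Qed.

Lemma normc_prod m (f : 'I_m -> R[i]) :
  Normc.normc (\prod_(k < m) f k) = \prod_(k < m) Normc.normc (f k).
Proof. by apply: big_morph; [exact: Normc.normcM | exact: Normc.normc1]. Qed.

Lemma circle_valueE a b m (c : 'I_m -> R[i]) z :
  circle_value a b (monic_roots c) z
  = Normc.normc (z - 1) `^ (2 * a - 1) * Normc.normc (z + 1) `^ (2 * b - 1)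
    * Normc.normc (\prod_(k < m) (z - c k)).
Proof.
rewrite /circle_value /monic_roots horner_prod; congr (_ * Normc.normc _).
by apply: eq_bigr => k _; rewrite hornerXsubC.
Qed.

(** The [sup] is a true upper bound because the values are bounded: |z - 1| and |z + 1| are at most
    2, and |z - c_k| is at most 1 + |c_k|. *)
Lemma circle_value_le_norm a b m (c : 'I_m -> R[i]) z :
    2^-1 <= a -> 2^-1 <= b -> Normc.normc z = 1 ->
  circle_value a b (monic_roots c) z <= circle_norm a b c.
Proof.
move=> ha hb hz; apply: ub_le_sup; last by exists z => //; rewrite circle_valueE.
exists (2 `^ (2 * a - 1) * 2 `^ (2 * b - 1) * \prod_(k < m) (1 + Normc.normc (c k))).
move=> _ [w /= hw <-].
have n1 : Normc.normc (1 : R[i]) = 1 by exact: Normc.normc1.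
have w1 : Normc.normc (w - 1) <= 2 by apply: le_trans (normcB_le _ _) _; rewrite hw n1.
have w2 : Normc.normc (w + 1) <= 2.
  rewrite -[1]opprK; apply: le_trans (normcB_le _ _) _.
  by rewrite hw -[Normc.normc (- 1)]/(Num.sqrt _) /= sqrrN oppr0 expr0n expr1n addr0 sqrtr1.
rewrite ler_pM ?mulr_ge0 ?powR_ge0 ?normc_ge0 //.
  by rewrite ler_pM ?powR_ge0 // ge0_ler_powR ?nnegrE ?normc_ge0 //; lra.
rewrite normc_prod; apply: ler_prod => k _; rewrite normc_ge0 /=.
by apply: le_trans (normcB_le _ _) _; rewrite hw.
Qed.

Lemma monic_roots_exists m (Q : {poly R[i]}) : Q \is monic -> size Q = m.+1 ->
  exists c : 'I_m -> R[i], monic_roots c = Q.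
Proof.
move=> Qm szQ; have [r Qr] := closed_field_poly_normal Q.
move/monicP: (Qm) Qr => -> ; rewrite scale1r => Qr.
have szr : size r = m.
  by move: szQ; rewrite Qr size_prod_XsubC => -[].
exists (fun k => r`_k).
by rewrite /monic_roots Qr (big_nth 0) szr big_mkord.
Qed.

Lemma monic_roots_monic m (c : 'I_m -> R[i]) : monic_roots c \is monic.
Proof. by apply: monic_prod => k _; exact: monicXsubC. Qed.

Lemma size_monic_roots m (c : 'I_m -> R[i]) : size (monic_roots c) = m.+1.
Proof.
rewrite /monic_roots -big_enum size_prod_XsubC -cardE; congr _.+1.
by rewrite -[RHS]card_ord; exact: eq_card.
Qed.

(* A polynomial with values at most M somewhere attaining M, that is the only
   monic one bounded by M, is the minimizer. *)
Lemma circle_min_unique a b m (q : 'I_m -> R[i]) (M : R) z0 :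
    2^-1 <= a -> 2^-1 <= b -> 
    (forall z, Normc.normc z = 1 -> circle_value a b (monic_roots q) z <= M) ->
    Normc.normc z0 = 1 -> circle_value a b (monic_roots q) z0 = M ->
    (forall c : 'I_m -> R[i],
      (forall z, Normc.normc z = 1 -> circle_value a b (monic_roots c) z <= M) ->
      monic_roots c = monic_roots q) ->
  circle_min a b m = M /\
  forall c : 'I_m -> R[i], circle_minimizer a b c <-> monic_roots c = monic_roots q.
Proof.
move=> ha hb qM hz0 qz0 uniq.
have normE (c : 'I_m -> R[i]) : monic_roots c = monic_roots q -> circle_norm a b c = M.
  move=> cq; apply: sup_max.
    by exists z0 => //; rewrite -circle_valueE cq.
  by move=> _ [z /= hz <-]; rewrite -circle_valueE cq; exact: qM.
have norm_le (c : 'I_m -> R[i]) : circle_norm a b c <= M -> monic_roots c = monic_roots q.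
  by move=> cM; apply: uniq => z hz; apply: le_trans cM; exact: circle_value_le_norm.
have minE : circle_min a b m = M.
  rewrite /circle_min; apply/eqP; rewrite eq_le; apply/andP; split.
    apply: ge_inf; last by exists q => //; exact: normE.
    exists 0 => _ [c _ <-]; apply: le_trans (circle_value_le_norm c ha hb hz0).
    exact: circle_value_ge0.
  apply: lb_le_inf; first by exists (circle_norm a b q), q.
  move=> _ [c _ <-]; rewrite leNgt; apply/negP => cM.
  by move: (cM); rewrite (normE c (norm_le c (ltW cM))) ltxx.
split=> // c; rewrite /circle_minimizer minE; split; last exact: normE.
by move=> cM; apply: norm_le; rewrite cM.
Qed.

Lemma prod_XsubC_perm n (c : nat -> R) (e : 'I_n -> R) :
  root_poly n c = \prod_(k < n) ('X - (e k)%:P) ->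
  perm_eq [seq c (val k) | k <- enum 'I_n] [seq e k | k <- enum 'I_n].
Proof.
move=> h; apply: prod_XsubC_eq; rewrite big_map big_enum [RHS]big_map big_enum /=; exact: h.
Qed.

(** The numbers e^(it) and e^(-it) have sum 2 cos t and product 1, and both products run over the
    same multiset of cosines. *)
Lemma circle_lift_joukowski n (t : 'I_n -> R) (s : nat -> R) :
    root_poly n s = \prod_(k < n) ('X - (cos (t k))%:P) ->
  circle_lift t = joukowski_lift n (fun k => (s k)%:C).
Proof.
move=> sE; have p := prod_XsubC_perm sE.
pose F (u : R) : {poly R[i]} := 'X^2 - (2 * u%:C)%:P * 'X + 1.
transitivity (\prod_(u <- [seq cos (t k) | k <- enum 'I_n]) F u); last first.
  rewrite -(perm_big _ p) big_map big_enum; exact: eq_bigr.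
rewrite big_map big_enum; apply: eq_bigr => k _.
have eE : expC (0 +i* t k) = cos (t k) +i* sin (t k).
  by rewrite /expC /= expR0 mul1r.
have eE' : expC (0 +i* - t k) = cos (t k) +i* - sin (t k).
  by rewrite /expC /= expR0 mul1r cosN sinN.
set zp := expC _ in eE *; set zm := expC _ in eE' *.
have e1 : zp + zm = 2 * (cos (t k))%:C.
  have -> : 2 * (cos (t k))%:C = (2 * cos (t k))%:C by rewrite rmorphM rmorph_nat.
  by rewrite eE eE'; apply/eqP; rewrite eq_complex /= addrN eqxx andbT; apply/eqP; ring.
have e2 : zp * zm = 1.
  rewrite eE eE'; apply/eqP; rewrite eq_complex /=; apply/andP.
  by split; apply/eqP; [rewrite -(cos2Dsin2 (t k))|]; ring.
have -> : F (cos (t k)) = 'X^2 - (zp + zm)%:P * 'X + (zp * zm)%:P.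
  by rewrite e1 e2.
by move: zp zm {eE eE' e1 e2} => zp zm; rewrite polyCD polyCM; ring.
Qed.

(** The energy bound gives Q weighted modulus at most K M on the circle, with equality at every
    node. A competitor bounded by K M is thus dominated by Q at the nodes, and [circle_extremal]
    makes it equal to Q. *)
Lemma circle_solution a b n (t : 'I_n -> R) :
    2^-1 <= a -> 2^-1 <= b -> (0 < n)%N -> interval_minimizer a b t ->
  exists q : 'I_n.*2.+1 -> R[i],
    [/\ ((2 * a + 2 * b + 2 * n%:R)^-1)%:C *: deriv_factor a b (circle_lift t)
          = monic_roots q,
        forall c : 'I_n.*2.+1 -> R[i],
          circle_minimizer a b c <-> monic_roots c = monic_roots q
      & circle_min a b n.*2.+1 = 2 `^ (n%:R + a + b - 1) * interval_min a b n].
Proof.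
move=> ha hb n0 tmin.
have [x [s [sE [xs xlo xhi] jac xM bound]]] := minimizer_structure ha hb n0 tmin.
set M := interval_min a b n in xM bound *; set K := 2 `^ _.
have nR : 0 <= n%:R :> R by [].
have N0 : 0 < 2 * a + 2 * b + 2 * n%:R by lra.
rewrite (circle_lift_joukowski sE).
set Q := _ *: _.
have [Qm szQ] := deriv_factor_monic (joukowski_lift_monic n (fun k => (s k)%:C))
  (size_joukowski_lift n (fun k => (s k)%:C)) N0.
rewrite -/Q in Qm szQ.
have QE u v : u ^+ 2 + v ^+ 2 = 1 -> Q.[u +i* v] = (2 * (u +i* v)) ^+ n
      * ((root_poly n.+1 x).[u] +i* (v * (root_poly n s).[u])).
  by move=> uv; apply: horner_deriv_factor_circle.
have xI i : (i <= n)%N -> -1 < x i < 1.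
  move=> ni; apply/andP; split.
    apply: (lt_le_trans xlo); case: i ni => // i ni.
    by apply/ltW/(interlaced_incr xs).
  apply: le_lt_trans xhi; move: ni; rewrite leq_eqVlt => /orP[/eqP->//|ni].
  by apply/ltW/(interlaced_incr xs); rewrite ni leqnn.
have M0 : 0 <= M by rewrite -(xM 0%N (leq0n n)).
have K0 : 0 <= K by exact: powR_ge0.
have Q_le z : Normc.normc z = 1 -> circle_value a b Q z <= K * M.
  case: z => u v hz.
  have uv : u ^+ 2 + v ^+ 2 = 1 by rewrite -normc_sqr hz expr1n.
  rewrite -(ler_pXn2r (isT : (0 < 2)%N)) ?nnegrE ?(mulr_ge0 K0 M0) //; last first.
    exact: circle_value_ge0.
  rewrite (circle_value_sqr a b uv (QE u v uv)) exprMn ler_wpM2l ?sqr_ge0 //.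
  apply: bound; rewrite -ler_norml -(ler_pXn2r (_ : (0 < 2)%N)) ?nnegrE //.
  by rewrite real_normK ?num_real // expr1n -uv lerDl sqr_ge0.
have Q_eq i e : (i <= n)%N -> circle_value a b Q (circle_point x i e) = K * M.
  move=> ni; have [h _] := circle_point_sqr e (xI i ni).
  have /andP[x1 x2] := xI i ni.
  have v0 := circle_value_ge0 a b Q (circle_point x i e).
  apply/eqP; rewrite -(eqrXn2 (isT : (0 < 2)%N) v0 (mulr_ge0 K0 M0)); apply/eqP.
  rewrite (circle_value_sqr a b h (QE _ _ h)) exprMn; congr (_ * _).
  rewrite -(xM i ni) real_normK ?num_real // exprMn weight_sqr; [|by rewrite !ltW|lra|lra].
  rewrite /energy !(hornerXn, horner_exp, hornerD, hornerN, hornerM, hornerC).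
  have -> : (root_poly n.+1 x).[x i] = 0.
    by rewrite horner_root_poly (bigD1 (Ordinal (ni : (i < n.+1)%N))) //= subrr mul0r.
  by ring.
have circ i e : (i <= n)%N -> Normc.normc (circle_point x i e) = 1.
  move=> ni; have [h _] := circle_point_sqr e (xI i ni).
  by rewrite /= in h *; rewrite h sqrtr1.
have [q qQ] := monic_roots_exists Qm szQ.
have [] := @circle_min_unique a b _ q (K * M) (circle_point x 0 true) ha hb.
- by move=> z hz; rewrite qQ Q_le.
- exact: circ.
- by rewrite qQ Q_eq.
- move=> c cM; rewrite qQ; apply: (circle_extremal (a := a) (b := b) xs xI Qm szQ _ _ QE).
  + exact: monic_roots_monic.
  + exact: size_monic_roots.
  + by move=> i e ni; rewrite (Q_eq i e ni); apply: cM; exact: circ.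
by move=> minE minP; exists q; split.
Qed.

(** The second minimizer is dominated by the first at the alternation points of the first, so
    [extremal_unique] equates the polynomials and hence the multisets of roots. *)
Lemma interval_minimizer_unique a b n (t t' : 'I_n -> R) :
    2^-1 <= a -> 2^-1 <= b -> (0 < n)%N ->
    interval_minimizer a b t -> interval_minimizer a b t' ->
  exists p : 'S_n, forall k, cos (t' k) = cos (t (p k)).
Proof.
move=> ha hb n0 tmin [_ tmin'].
have [x [s [sE [xs xlo xhi] jac xM bound]]] := minimizer_structure ha hb n0 tmin.
have xI i : (i <= n)%N -> -1 < x i < 1.
  move=> ni; apply/andP; split.
    apply: (lt_le_trans xlo); case: i ni => // i ni.
    by apply/ltW/(interlaced_incr xs).
  apply: le_lt_trans xhi; move: ni; rewrite leq_eqVlt => /orP[/eqP->//|ni].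
  by apply/ltW/(interlaced_incr xs); rewrite ni leqnn.
set g := \prod_(k < n) ('X - (cos (t' k))%:P).
have a0 : 0 <= a by lra. have b0 : 0 <= b by lra.
have [_ [_ _ hmax]] := interval_normP a0 b0 (erefl g).
have gE : g = root_poly n s.
  apply: (extremal_unique xs xI (a := a) (b := b)).
  - by apply: monic_prod => k _; exact: monicXsubC.
  - rewrite /g -big_enum size_prod_XsubC -cardE; congr _.+1.
    by rewrite -[RHS]card_ord; exact: eq_card.
  - move=> i ni; rewrite xM // -tmin'; apply: hmax.
    by case/andP: (xI i ni) => /ltW-> /ltW->.
have : perm_eq [seq cos (t' k) | k <- enum 'I_n] [seq cos (t k) | k <- enum 'I_n].
  apply: prod_XsubC_eq; rewrite big_map big_enum [RHS]big_map big_enum /=.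
  by rewrite -sE; exact: gE.
move=> pe; have := pe.
have -> : [seq cos (t k) | k <- enum 'I_n] = [tuple cos (t k) | k < n].
  by [].
move/tuple_permP => [p pE]; exists p => k.
have := congr1 (fun r => nth 0 r k) pE.
by rewrite (nth_map k) ?size_enum_ord // nth_ord_enum (nth_map k) ?size_enum_ord // nth_ord_enum tnth_mktuple.
Qed.

End CircleMin.

(** * Complex derivative of the branches of the weighted product *)

Section ComplexDerivative.
Context {R : realType}.
Implicit Types (z w k h d : R[i]) (s e : R).

Lemma expCD z w : expC (z + w) = expC z * expC w.
Proof.
case: z w => [x y] [x' y']; rewrite /expC /= expRD cosD sinD.
by apply/eqP; rewrite eq_complex /=; apply/andP; split; apply/eqP; ring.
Qed.

Lemma expC0 : expC (0 : R[i]) = 1.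
Proof. by rewrite /expC /= expR0 cos0 sin0 mul1r. Qed.

Lemma expC_neq0 z : expC z != 0.
Proof.
have := expCD z (- z); rewrite subrr expC0 => h.
by apply/eqP => z0; move/eqP: h; rewrite z0 mul0r oner_eq0.
Qed.

Lemma normcD_le z w : Normc.normc (z + w) <= Normc.normc z + Normc.normc w.
Proof. by have := ler_normD z w; rewrite !normcE -rmorphD lecR. Qed.

Lemma ReIm_le_normc (x y : R) :
  [/\ `|x| <= Normc.normc (x +i* y), `|y| <= Normc.normc (x +i* y)
    & Normc.normc (x +i* y) <= `|x| + `|y|].
Proof.
split.
- by rewrite /= -[leLHS]sqrtr_sqr ler_sqrt ?addr_ge0 ?sqr_ge0 // lerDl sqr_ge0.
- by rewrite /= -[leLHS]sqrtr_sqr ler_sqrt ?addr_ge0 ?sqr_ge0 // lerDr sqr_ge0.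
- rewrite -(ler_pXn2r (isT : (0 < 2)%N)) ?nnegrE ?addr_ge0 ?normc_ge0 //.
  rewrite normc_sqr sqrrD !real_normK ?num_real // -addrA lerD2l lerDr.
  by rewrite mulrn_wge0 // mulr_ge0.
Qed.

Lemma derive_approx (f : R -> R) (a : R) : is_derive (0 : R) (1 : R) f a ->
  forall e, 0 < e -> exists2 r, 0 < r &
    forall x, `|x| < r -> `|f x - f 0 - a * x| <= e * `|x|.
Proof.
move=> [fd fa] e e0; have cf : h^-1 *: (f (h *: 1 + 0) - f 0) @[h --> 0^'] --> a.
  by rewrite -fa.
have /cvgrPdist_le/(_ e e0)/nbhs_normP[r /= r0 hr] := cf.
exists r => // x xr; have [->|x0] := eqVneq x 0.
  by rewrite mulr0 subrr subr0 normr0 mulr0.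
have := hr x; rewrite /ball_ /= sub0r normrN => /(_ xr x0).
rewrite /GRing.scale /= mulr1 addr0 => h.
have -> : f x - f 0 - a * x = - ((a - x^-1 * (f x - f 0)) * x) by field.
by rewrite normrN normrM ler_wpM2r.
Qed.

Lemma expC_approx e : 0 < e -> exists2 r, 0 < r &
  forall k, Normc.normc k < r -> Normc.normc (expC k - 1 - k) <= e * Normc.normc k.
Proof.
move=> e0.
have de : is_derive (0 : R) (1 : R) (@expR R) 1 by apply: is_derive_eq; rewrite expR0.
have dc : is_derive (0 : R) (1 : R) (@cos R) 0 by apply: is_derive_eq; rewrite sin0 oppr0.
have ds : is_derive (0 : R) (1 : R) (@sin R) 1 by apply: is_derive_eq; rewrite cos0.
(* The errors of the real and imaginary parts add up to at most 9 t |k|, well within e |k|. *)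
pose t := Num.min 1 (e / 20).
have t0 : 0 < t by rewrite lt_min ltr01 divr_gt0.
have t1 : t <= 1 by rewrite ge_min lexx.
have te : t <= e / 20 by rewrite ge_min lexx orbT.
clearbody t.
have [r1 r10 h1] := derive_approx de t0.
have [r2 r20 h2] := derive_approx dc t0.
have [r3 r30 h3] := derive_approx ds t0.
exists (Num.min (Num.min r1 r2) (Num.min r3 t)).
  by rewrite !lt_min r10 r20 r30 t0.
move=> [x y]; rewrite !lt_min => /andP[/andP[k1 k2] /andP[k3 kt]].
have [nx ny nxy] := ReIm_le_normc x y; set N := Normc.normc _ in k1 k2 k3 kt nx ny nxy *.
have {}h1 := h1 x (le_lt_trans nx k1).
have {}h2 := h2 y (le_lt_trans ny k2).
have {}h3 := h3 y (le_lt_trans ny k3).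
rewrite expR0 mul1r in h1; rewrite cos0 mul0r subr0 in h2; rewrite sin0 subr0 mul1r in h3.
have N0 : 0 <= N by exact: normc_ge0.
have H1 : `|expR x - 1 - x| <= t * N by apply: le_trans h1 _; rewrite ler_wpM2l // ltW.
have H2 : `|cos y - 1| <= t * N by apply: le_trans h2 _; rewrite ler_wpM2l // ltW.
have H3 : `|sin y - y| <= t * N by apply: le_trans h3 _; rewrite ler_wpM2l // ltW.
have N1 : N <= 1 by lra.
have tN : t * N <= N by rewrite ler_piMl.
have E1 : `|expR x - 1| <= 2 * N.
  have -> : expR x - 1 = (expR x - 1 - x) + x by ring.
  by apply: le_trans (ler_normD _ _) _; lra.
have E3 : `|expR x| <= 3.
  have -> : expR x = (expR x - 1) + 1 by ring.
  by apply: le_trans (ler_normD _ _) _; rewrite normr1; lra.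
have -> : expC (x +i* y) - 1 - x +i* y
    = (expR x * (cos y - 1) + (expR x - 1 - x)) +i* (expR x * (sin y - y) + (expR x - 1) * y).
  by apply/eqP; rewrite /expC eq_complex /=; apply/andP; split; apply/eqP; ring.
have [_ _ H] := ReIm_le_normc (expR x * (cos y - 1) + (expR x - 1 - x)) (expR x * (sin y - y) + (expR x - 1) * y).
apply: (le_trans H).
have A1 : `|expR x * (cos y - 1) + (expR x - 1 - x)| <= 3 * (t * N) + t * N.
  apply: le_trans (ler_normD _ _) _; apply: lerD => //; rewrite normrM.
  by apply: ler_pM.
have A2 : `|expR x * (sin y - y) + (expR x - 1) * y| <= 3 * (t * N) + 2 * N * t.
  apply: le_trans (ler_normD _ _) _; rewrite !normrM; apply: lerD; apply: ler_pM => //.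
  exact: le_trans ny (ltW kt).
have tN' : t * N <= (e * N) / 20 by rewrite mulrAC ler_wpM2r.
have eN : 0 <= e * N by rewrite mulr_ge0 // ltW.
rewrite (_ : 2 * N * t = 2 * (t * N)) in A2; last by ring.
move: (t * N) (e * N) tN' eN A1 A2 {H} => c1 c2.
by move=> tN' eN A1 A2; lra.
Qed.

(** Differentiability tested with real radii and errors: a positive element of [R[i]] has zero
    imaginary part. *)
Lemma is_derive_normc (f : R[i]^o -> R[i]^o) z d :
    (forall e, 0 < e -> exists2 r, 0 < r & forall h, Normc.normc h < r ->
       Normc.normc (f (z + h) - f z - d * h) <= e * Normc.normc h) ->
  is_derive (z : R[i]^o) 1 f d.
Proof.
move=> H.
have cf : h^-1 *: (f (h *: 1 + z) - f z) @[h --> (0 : R[i]^o)^'] --> (d : R[i]^o).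
  apply/cvgrPdist_le => -[e e'] /=; rewrite ltcE /= => /andP[/eqP -> e0].
  have [r r0 hr] := H e e0.
  have r0' : 0 < r%:C by rewrite ltcR.
  have key : \forall h \near (0 : R[i]^o),
      h != 0 -> `|d - h^-1 *: (f (h *: 1 + z) - f z)| <= e%:C.
    apply/nbhs_norm0P; exists r%:C => // h hlt h0.
    have {hlt} /hr hh : Normc.normc h < r by rewrite -ltcR; exact: hlt.
    rewrite /GRing.scale /= mulr1.
    have -> : d - h^-1 * (f (h + z) - f z) = - ((f (z + h) - f z - d * h) / h).
      by rewrite (addrC h z); field.
    rewrite normrN normf_div ler_pdivrMr ?normr_gt0 //.
    by rewrite !normcE -rmorphM lecR.
  exact: key.
by split; [apply/cvg_ex; exists d | apply: cvg_lim].
Qed.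

(** Continuity of L suffices: the increment K of L satisfies exp K = 1 + h/(z - c) and tends to 0,
    so the expansion of exp gives K = h/(z - c) to first order. The same expansion at s K then gives
    the increment of the power. *)
Lemma is_derive_branch_pow (U : set R[i]^o) c L s (z : R[i]^o) :
    log_branch U c L -> U z ->
  is_derive z 1 (branch_pow L s : R[i]^o -> R[i]^o) (s%:C / (z - c) * branch_pow L s z).
Proof.
move=> [oU cL eL] Uz; apply: is_derive_normc => e e0.
have zc : z - c != 0 by rewrite -(eL z Uz) expC_neq0.
set E := branch_pow L s z; set d := z - c in zc *.
pose S := Normc.normc (s%:C : R[i]).
have S0 : 0 <= S by exact: normc_ge0.
have D0 : 0 < Normc.normc d.
  rewrite lt_neqAle normc_ge0 andbT eq_sym; apply: contra zc => /eqP/Normc.eq0_normc.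
  by move=> ->.
(* The total error is t (Q - 1) |h|; the added 1 keeps Q positive. The bound t <= 1/2 below yields
   |K| <= 2 |h/d|. *)
pose Q := 4 * Normc.normc E * S / Normc.normc d + 1.
have Q0 : 0 < Q.
  by rewrite /Q ltr_wpDl // divr_ge0 ?mulr_ge0 ?normc_ge0.
pose t := Num.min (1 / 2) (e / Q).
have t0 : 0 < t by rewrite lt_min !divr_gt0.
have t2 : t <= 1 / 2 by rewrite ge_min lexx.
have tQ : t <= e / Q by rewrite ge_min lexx orbT.
have [r r0 hr] := expC_approx t0.
(* Keeping |K| below r/(S+1) puts both K and s K in the range of the expansion. *)
have [r1 r10 hr1] : exists2 r1, 0 < r1 & forall h, Normc.normc h < r1 ->
    U (z + h) /\ Normc.normc (L (z + h) - L z) < r / (S + 1).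
  have q0 : 0 < r / (S + 1) by rewrite divr_gt0 // ltr_wpDl.
  have q0' : 0 < (r / (S + 1))%:C by rewrite ltcR.
  have zU : z \in U by rewrite inE.
  have nU : nbhs z U by exact: open_nbhs_nbhs.
  have /cvgrPdist_lt/(_ _ q0') nL := cL z zU.
  have key : \forall w \near (z : R[i]^o), U w /\ `|L z - L w| < (r / (S + 1))%:C.
    exact: filterI nU nL.
  have /nbhs_normP[[a a'] a0 ha] := key.
  move: a0 ha; rewrite /= ltcE /= => /andP[/eqP -> a0] ha.
  exists a => // h hh; have [] := ha (z + h).
    by rewrite /ball_ /= opprD addNKr normrN normcE ltcR.
  by move=> h1; rewrite distrC normcE ltcR.
exists r1 => // h /hr1[Uh]; set K := L (z + h) - L z => Kr.
have Kr' : Normc.normc K < r.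
  apply: (lt_le_trans Kr); rewrite ler_pdivrMr ?ltr_wpDl //.
  by rewrite mulrDr mulr1 lerDr mulr_ge0 // ltW.
have sKr : Normc.normc (s%:C * K) < r.
  rewrite Normc.normcM -/S; apply: (@le_lt_trans _ _ (S * (r / (S + 1)))).
    by rewrite ler_wpM2l // ltW.
  rewrite mulrA ltr_pdivrMr ?ltr_wpDl //; rewrite mulrDr mulr1 mulrC ltrDl.
  exact: r0.
have eK : expC K = 1 + h / d.
  have := eL _ Uh; have -> : L (z + h) = L z + K by rewrite [RHS]addrC subrK.
  rewrite expCD (eL z Uz) -/d => h1.
  apply: (mulfI zc); rewrite h1 mulrDr mulr1 mulrCA divff // mulr1 /d; ring.
have b1 := hr K Kr'; have b2 := hr _ sKr.
have b3 : Normc.normc (h / d) = Normc.normc h / Normc.normc d.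
  by rewrite Normc.normcM Normc.normcV.
rewrite eK (_ : 1 + h / d - 1 - K = h / d - K) in b1; last by ring.
have nK : Normc.normc K <= 2 * (Normc.normc h / Normc.normc d).
  have := normcB_le (h / d) (h / d - K); rewrite opprB addrC subrK b3 => h1.
  have : t * Normc.normc K <= 1 / 2 * Normc.normc K by rewrite ler_wpM2r ?normc_ge0.
  by move: h1 b1; lra.
have -> : branch_pow L s (z + h) - E - s%:C / d * E * h
    = E * ((expC (s%:C * K) - 1 - s%:C * K) - s%:C * (h / d - K)).
  rewrite /branch_pow (_ : L (z + h) = L z + K); last by rewrite [RHS]addrC subrK.
  rewrite mulrDr expCD -/(branch_pow L s z) -/E; ring.
rewrite Normc.normcM.
have b4 : Normc.normc (expC (s%:C * K) - 1 - s%:C * K - s%:C * (h / d - K))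
    <= 2 * (S * (t * Normc.normc K)).
  apply: (le_trans (normcB_le _ _)); rewrite (Normc.normcM (s%:C)) -/S.
  have : S * Normc.normc (h / d - K) <= S * (t * Normc.normc K) by rewrite ler_wpM2l.
  by move: b2; rewrite Normc.normcM -/S mulrCA; lra.
apply: (@le_trans _ _ (Normc.normc E * (2 * (S * (t * (2 * (Normc.normc h / Normc.normc d))))))).
  rewrite ler_wpM2l ?normc_ge0 //; apply: (le_trans b4).
  by rewrite !ler_wpM2l // ltW.
have -> : Normc.normc E * (2 * (S * (t * (2 * (Normc.normc h / Normc.normc d)))))
    = t * (Q - 1) * Normc.normc h by rewrite /Q; ring.
rewrite ler_wpM2r ?normc_ge0 //.
apply: (@le_trans _ _ (e / Q * (Q - 1))); first by rewrite ler_wpM2r // /Q addrK divr_ge0 ?mulr_ge0 ?normc_ge0.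
by rewrite mulrAC ler_pdivrMr // ler_pM2l // gerDl lerN10.
Qed.

Lemma is_derive_horner_complex (p : {poly R[i]}) (z : R[i]^o) :
  is_derive z 1 (fun x : R[i]^o => p.[x] : R[i]^o) p^`().[z].
Proof.
elim/poly_ind: p => [|p c IH].
  have -> : (fun x : R[i]^o => (0 : {poly R[i]}).[x] : R[i]^o) = cst 0.
    by apply/funext => x; rewrite horner0.
  by rewrite deriv0 horner0; exact: is_derive_cst.
have -> : (fun x : R[i]^o => (p * 'X + c%:P).[x] : R[i]^o)
    = (fun x => p.[x] : R[i]^o) * id + cst c.
  by apply/funext => x; rewrite hornerMXaddC.
have h : is_derive z 1 ((fun x : R[i]^o => p.[x] : R[i]^o) * id)
    (p.[z] *: (1 : R[i]^o) + z *: (p^`().[z] : R[i]^o)).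
  by apply: is_deriveM.
have h' : is_derive z 1 (((fun x : R[i]^o => p.[x] : R[i]^o) * id) + cst c)
    (p.[z] *: (1 : R[i]^o) + z *: (p^`().[z] : R[i]^o) + 0).
  by apply: is_deriveD.
apply: (is_derive_eq h').
by rewrite derivMXaddC hornerD hornerM hornerX /GRing.scale /= addr0; ring.
Qed.

(** Product rule, after writing each power of exponent s as the power of exponent s - 1 from the
    same logarithm times z - c. *)
Lemma is_derive_weighted_lift (a b : R) n (t : 'I_n -> R) (U : set R[i]^o)
    (La Lb : R[i]^o -> R[i]^o) (z : R[i]^o) :
    log_branch U 1 La -> log_branch U (-1) Lb -> U z ->
  is_derive z 1 (weighted_lift a b t La Lb : R[i]^o -> R[i]^o)
    (branch_pow La (2 * a - 1) z * branch_pow Lb (2 * b - 1) z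
      * (deriv_factor a b (circle_lift t)).[z]).
Proof.
move=> hLa hLb Uz.
have da := is_derive_branch_pow (2 * a) hLa Uz.
have db := is_derive_branch_pow (2 * b) hLb Uz.
have dl := is_derive_horner_complex (circle_lift t) z.
have pow c L s : log_branch U c L -> branch_pow L s z = branch_pow L (s - 1) z * (z - c).
  move=> [_ _ eL]; rewrite -(eL z Uz) /branch_pow -expCD; congr expC.
  by rewrite rmorphB mulrBl mul1r subrK.
have neq0 c L : log_branch U c L -> z - c != 0.
  by move=> [_ _ eL]; rewrite -(eL z Uz) expC_neq0.
have z1 := neq0 _ _ hLa; have z2 := neq0 _ _ hLb.
apply: (is_derive_eq (is_deriveM (is_deriveM da db) dl)).
rewrite /GRing.scale /=.
rewrite [X in X * _^`().[z]](_ : _ = branch_pow La (2 * a) z * branch_pow Lb (2 * b) z) //.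
rewrite (pow _ _ _ hLa) (pow _ _ _ hLb) /deriv_factor.
rewrite !(hornerXn, horner_exp, hornerD, hornerN, hornerM, hornerC, hornerX, hornerZ).
move: (branch_pow _ _ _) (branch_pow _ _ _) ((2 * a)%:C) ((2 * b)%:C) z1 z2.
rewrite opprK => A B a' b' z1 z2.
by field; rewrite z1.
Qed.

End ComplexDerivative.

Unset Implicit Arguments.

Theorem theorem4p3 (R : realType) (ra rb : R) (n : nat)
    (hra : 2^-1 <= ra) (hrb : 2^-1 <= rb) (hn : (0 < n)%N) :
  [/\ (* existence of the minimizing angles, uniqueness of their cosines *)
      exists t : 'I_n -> R, interval_minimizer ra rb t,
      forall t t' : 'I_n -> R,
        interval_minimizer ra rb t -> interval_minimizer ra rb t' ->
        exists s : 'S_n, forall k, cos (t' k) = cos (t (s k)),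
      forall t : 'I_n -> R, interval_minimizer ra rb t ->
        exists a : 'I_n.*2.+1 -> R[i],
          [/\ (* the normalized derivative is the weight times prod (z - a_k),
                 for every consistent choice of branches of the powers *)
              forall (U : set R[i]^o) (La Lb : R[i]^o -> R[i]^o),
                log_branch U 1 La -> log_branch U (-1) Lb ->
                forall z : R[i]^o, U z ->
                  derivable (weighted_lift ra rb t La Lb) z 1 /\
                  ((2 * ra + 2 * rb + 2 * n%:R)^-1)%:C
                    * derive1 (weighted_lift ra rb t La Lb) z
                  = branch_pow La (2 * ra - 1) z * branch_pow Lb (2 * rb - 1) z
                    * \prod_(k < n.*2.+1) (z - a k),
              (* the same identity after division by the weight *)
              ((2 * ra + 2 * rb + 2 * n%:R)^-1)%:C
                *: deriv_factor ra rb (circle_lift t) = monic_roots a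
            & (* prod (z - a_k) is the unique minimizing polynomial *)
              forall b : 'I_n.*2.+1 -> R[i],
                circle_minimizer ra rb b <-> monic_roots b = monic_roots a]
    & circle_min ra rb n.*2.+1
      = 2 `^ (n%:R + ra + rb - 1) * interval_min ra rb n].
Proof.
have a0 : 0 <= ra by lra. have b0 : 0 <= rb by lra.
have [t0 ht0] := @interval_minimizer_exists R ra rb n a0 b0.
split.
- by exists t0.
- by move=> t t'; exact: interval_minimizer_unique.
- move=> t ht; have [q [qE qP _]] := circle_solution hra hrb hn ht.
  exists q; split=> // U La Lb hLa hLb z Uz.
  have [d dE] := is_derive_weighted_lift ra rb t hLa hLb Uz.
  split=> //; rewrite derive1E dE mulrCA; congr (_ * _).
  rewrite -hornerZ qE /monic_roots horner_prod.
  by apply: eq_bigr => k _; rewrite hornerXsubC.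
- by have [q [_ _ ->]] := circle_solution hra hrb hn ht0.
Qed.
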